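(* Let $B_\tau=1$, $C_\tau=\tau$, $\bar{B}_\tau=1-\tau$, and let $$\bar{A}_{\tau,\sigma}=\alpha_{(0,0)}-\tfrac12\xi_1P_1(\sigma)+\tfrac12\xi_1P_1(\tau)+\sum_{\substack{i+j\ \text{even}\\ i+j>1}}\alpha_{(i,j)}P_i(\tau)P_j(\sigma),$$ with $\xi_1=\frac{1}{2\sqrt3}$ and real coefficients $\alpha_{(i,j)}$ (with only finitely many nonzero, or such that the series converges uniformly on $[0,1]^2$). Then the csRKN method $(\bar{A}_{\tau,\sigma},\bar{B}_\tau,B_\tau,C_\tau)$ is symmetric and of order at least $2$. If in addition $\alpha_{(0,0)}=\frac16$, it is of order at least $4$. If moreover $$\alpha_{(0,0)}=\tfrac16,\quad \alpha_{(1,1)}=-\tfrac1{10},\quad \alpha_{(2,0)}=\alpha_{(0,2)}=\tfrac{\sqrt5}{60},\quad \alpha_{(i,0)}=0\ \text{for all even } i>2,$$ then it is of order at least $6$.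
   Context: Consider $q''=f(t,q)$, $q(t_0)=q_0$, $q'(t_0)=q'_0$ with $f:\mathbb{R}\times\mathbb{R}^d\to\mathbb{R}^d$ smooth. The csRKN method with coefficients $(\bar{A}_{\tau,\sigma},\bar{B}_\tau,B_\tau,C_\tau)$ and step size $h$ is $$Q_\tau=q_0+hC_\tau q'_0+h^2\int_0^1\bar{A}_{\tau,\sigma}f(t_0+C_\sigma h,Q_\sigma)\,d\sigma,\ \tau\in[0,1],$$ $$q_1=q_0+hq'_0+h^2\int_0^1\bar{B}_\tau f(t_0+C_\tau h,Q_\tau)\,d\tau,\qquad q'_1=q'_0+h\int_0^1 B_\tau f(t_0+C_\tau h,Q_\tau)\,d\tau.$$ The method is of order $p$ if for every such problem with smooth $f$, $q(t_0+h)-q_1=O(h^{p+1})$ and $q'(t_0+h)-q'_1=O(h^{p+1})$ as $h\to0$. A one-step method $\Phi_h$ is symmetric if $\Phi_h=\Phi_{-h}^{-1}$. $P_k$ is the normalized shifted Legendre polynomial: $P_0=1$, $P_k(x)=\frac{\sqrt{2k+1}}{k!}\frac{d^k}{dx^k}[(x^2-x)^k]$, orthonormal on $[0,1]$. *)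

(* Defs.v *)
From Stdlib Require Import Reals Lra Lia List Bool Arith Factorial.
From Stdlib Require Vectors.Fin.
Import ListNotations.
Open Scope R_scope.

(* ---------- Polynomials as coefficient lists (lowest degree first) ---------- *)
Fixpoint padd (p q : list R) : list R :=
  match p, q with
  | [], _ => q
  | _, [] => p
  | a :: p', b :: q' => (a + b) :: padd p' q'
  end.

Definition pscale (c : R) (p : list R) : list R := map (Rmult c) p.

Fixpoint pmul (p q : list R) : list R :=
  match p with
  | [] => []
  | a :: p' => padd (pscale a q) (0 :: pmul p' q)
  end.

Definition ppow (p : list R) (k : nat) : list R := Nat.iter k (pmul p) [1].

Fixpoint pderiv_aux (n : nat) (p : list R) : list R :=
  match p with
  | [] => []
  | a :: p' => (INR n * a) :: pderiv_aux (S n) p'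
  end.

Definition pderiv (p : list R) : list R :=
  match p with [] => [] | _ :: p' => pderiv_aux 1 p' end.

Definition peval (p : list R) (x : R) : R :=
  fold_right (fun a acc => a + x * acc) 0 p.

(* Normalized shifted Legendre polynomial via Rodrigues' formula:
   P_k(x) = sqrt(2k+1)/k! * d^k/dx^k [(x^2 - x)^k]. *)
Definition shleg (k : nat) (x : R) : R :=
  sqrt (INR (2 * k + 1)) / INR (fact k)
  * peval (Nat.iter k pderiv (ppow [0; -1; 1] k)) x.

Definition Vec (d : nat) := Fin.t d -> R.

Definition shift {d : nat} (x : Vec d) (i : Fin.t d) (s : R) : Vec d :=
  fun j => x j + (if Fin.eqb i j then s else 0).

Definition C0 {d : nat} (g : R -> Vec d -> R) : Prop :=
  forall t x eps, 0 < eps -> exists delta, 0 < delta /\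
    forall t' x', Rabs (t' - t) < delta ->
      (forall i, Rabs (x' i - x i) < delta) ->
      Rabs (g t' x' - g t x) < eps.

Fixpoint Ck {d : nat} (k : nat) (g : R -> Vec d -> R) : Prop :=
  match k with
  | O => C0 g
  | S k' =>
      C0 g /\
      (exists gt : R -> Vec d -> R,
          (forall t x, derivable_pt_lim (fun s => g s x) t (gt t x)) /\ Ck k' gt) /\
      (exists gx : Fin.t d -> R -> Vec d -> R,
          (forall i t x, derivable_pt_lim (fun s => g t (shift x i s)) 0 (gx i t x)) /\
          forall i, Ck k' (gx i))
  end.

Definition smooth {d : nat} (f : R -> Vec d -> Vec d) : Prop :=
  forall (k : nat) (i : Fin.t d), Ck k (fun t x => f t x i).

Definition integral01 (g : R -> R) (v : R) : Prop :=
  exists pr : Riemann_integrable g 0 1, RiemannInt pr = v.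

Definition csrkn_step (Abar : R -> R -> R) (Bbar B C : R -> R)
  {d : nat} (f : R -> Vec d -> Vec d) (t0 h : R) (q0 v0 : Vec d)
  (Q : R -> Vec d) (q1 v1 : Vec d) : Prop :=
  let F := fun s => f (t0 + C s * h) (Q s) in
  (forall tau, 0 <= tau <= 1 -> forall i, exists I,
     integral01 (fun s => Abar tau s * F s i) I /\
     Q tau i = q0 i + h * C tau * v0 i + h ^ 2 * I) /\
  (forall i, exists I, integral01 (fun s => Bbar s * F s i) I /\
     q1 i = q0 i + h * v0 i + h ^ 2 * I) /\
  (forall i, exists I, integral01 (fun s => B s * F s i) I /\
     v1 i = v0 i + h * I).

(* Symmetry Phi_h = Phi_{-h}^{-1}, in relational form: whenever
   (q1, v1) is a step of size h from (t0, q0, v0), then (q0, v0) is a step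
   of size -h from (t0 + h, q1, v1). *)
Definition csrkn_symmetric (Abar : R -> R -> R) (Bbar B C : R -> R) : Prop :=
  forall (d : nat) (f : R -> Vec d -> Vec d), smooth f ->
  forall t0 h (q0 v0 : Vec d) Q q1 v1,
    csrkn_step Abar Bbar B C f t0 h q0 v0 Q q1 v1 ->
    exists Q', csrkn_step Abar Bbar B C f (t0 + h) (- h) q1 v1 Q' q0 v0.

Definition csrkn_order_at_least (Abar : R -> R -> R) (Bbar B C : R -> R)
  (p : nat) : Prop :=
  forall (d : nat) (f : R -> Vec d -> Vec d), smooth f ->
  forall (t0 : R) (q0 v0 : Vec d) (r : R) (q v : R -> Vec d),
    0 < r ->
    (forall t, t0 - r < t < t0 + r -> forall i,
        derivable_pt_lim (fun s => q s i) t (v t i) /\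
        derivable_pt_lim (fun s => v s i) t (f t (q t) i)) ->
    q t0 = q0 -> v t0 = v0 ->
    forall M : R, exists K h1, 0 < h1 /\
      forall h Q q1 v1, Rabs h < h1 ->
        csrkn_step Abar Bbar B C f t0 h q0 v0 Q q1 v1 ->
        (forall tau, 0 <= tau <= 1 -> forall i, Rabs (Q tau i - q0 i) <= M) ->
        forall i,
          Rabs (q (t0 + h) i - q1 i) <= K * Rabs h ^ (p + 1) /\
          Rabs (v (t0 + h) i - v1 i) <= K * Rabs h ^ (p + 1).

Fixpoint fsum (n : nat) (g : nat -> R) : R :=
  match n with O => 0 | S n' => fsum n' g + g n' end.

Definition xi1 : R := 1 / (2 * sqrt 3).

Definition Abar_base (alpha : nat -> nat -> R) (tau sigma : R) : R :=
  alpha 0%nat 0%nat - / 2 * xi1 * shleg 1 sigma + / 2 * xi1 * shleg 1 tau.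

Definition Abar_psum (alpha : nat -> nat -> R) (n : nat) (tau sigma : R) : R :=
  fsum n (fun i => fsum n (fun j =>
    if Nat.even (i + j) && Nat.ltb 1 (i + j)
    then alpha i j * shleg i tau * shleg j sigma else 0)).

(* Main.v *)
(* Write E = Q - q for the stage error and D = f(t, Q) - f(t, q) for the error it
   causes in the right-hand side.  With B = 1, C = tau, Bbar = 1 - tau the final
   quadratures are exact on the solution, so the local errors are
   -h^2 int (1 - s) D ds and -h int D ds, and everything depends on how small these
   integrals are.  Taylor expansion along the solution gives
     E = h^2 sum_k c_k h^k e_k + h^2 int Abar D + O(h^6),   D = f_q E + O(|E|^2),
   where e_k(tau) = int Abar(tau, s) s^k ds - tau^(k+2) / ((k+1)(k+2)).  Bootstrapping
   yields D explicitly up to O(h^p), and its coefficients integrate to zero because of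
   finitely many moment identities for Abar, which follow from the orthogonality of P_k
   to lower degrees.  The one term beyond moments, int int Abar e_1, vanishes since
   e_1 is odd about 1/2, a consequence of the same reflection identity
   Abar(1 - tau, s) = Abar(tau, 1 - s) + 1 - s - tau that gives the symmetry of the
   method via Q'(tau) = Q(1 - tau). *)
Require Import Defs.
From Stdlib Require Import Reals Lra Lia List.
From Coquelicot Require Import Coquelicot.
From Stdlib Require Import FunctionalExtensionality IndefiniteDescription Classical FinFun.
Import ListNotations.
Open Scope R_scope.

(** * Integration over [0,1] *)

(** Bookkeeping of the orders: the position update carries h^2 and the velocity update h, so order p
    asks for int (1 - s) D = O(h^(p-1)) and int D = O(h^p). A term s^a e_k enters D with h^(a+k+2),
    so the velocity requires int s^a e_k = 0 for a + k <= p - 3. The weight 1 - s raises a by one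
    but is needed one order lower, so it adds no further moments. For p = 4 this leaves three pairs
    (a,k). For p = 6 the column alpha(i,0) is chosen to make e_0 vanish identically, and six pairs
    with k >= 1 remain. Since E then starts at h^3, the quadratic error |E|^2 is already O(h^6) and
    only linear terms have to be expanded. Three obstacles shape the estimates. The stages are known
    only through the existence of some integrals and a bound M, so all constants must be uniform
    over every such step. Smoothness of f means iterated partial derivatives, so the chain rule and
    the quadratic estimate are built coordinate by coordinate. The kernel is only a uniform limit,
    so its identities are proved for truncations, on which they hold exactly from some index on. *)

Definition ex01 (g : R -> R) : Prop := ex_RInt (V := R_NormedModule) g 0 1.
Definition I01 (g : R -> R) : R := RInt (V := R_CompleteNormedModule) g 0 1.

Lemma is_RInt_I01 (g : R -> R) : ex01 g -> is_RInt (V := R_NormedModule) g 0 1 (I01 g).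
Proof. intros H; exact (RInt_correct (V := R_CompleteNormedModule) g 0 1 H). Qed.

Lemma I01_unique (g : R -> R) (l : R) : is_RInt (V := R_NormedModule) g 0 1 l -> I01 g = l.
Proof. exact (is_RInt_unique (V := R_CompleteNormedModule) g 0 1 l). Qed.

(** The bridge between the Riemann integral of the method's definition and the total Coquelicot
    integral, in which all later computations take place. *)
Lemma integral01_I01 (g : R -> R) (l : R) :
  integral01 g l <-> ex01 g /\ I01 g = l.
Proof.
split.
- intros [pr <-]; split; [exact (ex_RInt_Reals_1 g 0 1 pr)|].
  exact (RInt_Reals g 0 1 pr).
- intros [H <-]. exists (ex_RInt_Reals_0 g 0 1 H).
  symmetry; apply (RInt_Reals g 0 1).
Qed.

Lemma ex01_ext (f g : R -> R) :
  (forall x, 0 <= x <= 1 -> f x = g x) -> ex01 f -> ex01 g.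
Proof.
intros H; apply ex_RInt_ext; intros x; rewrite Rmin_left, Rmax_right by lra.
intros; apply H; lra.
Qed.

Lemma I01_ext (f g : R -> R) :
  (forall x, 0 <= x <= 1 -> f x = g x) -> I01 f = I01 g.
Proof.
intros H; apply (RInt_ext (V := R_CompleteNormedModule)).
intros x; rewrite Rmin_left, Rmax_right by lra; intros; apply H; lra.
Qed.

Lemma ex01_plus (f g : R -> R) : ex01 f -> ex01 g -> ex01 (fun x => f x + g x).
Proof. exact (ex_RInt_plus (V := R_NormedModule) f g 0 1). Qed.

Lemma I01_plus (f g : R -> R) :
  ex01 f -> ex01 g -> I01 (fun x => f x + g x) = I01 f + I01 g.
Proof. exact (RInt_plus (V := R_CompleteNormedModule) f g 0 1). Qed.

Lemma ex01_scal (c : R) (f : R -> R) : ex01 f -> ex01 (fun x => c * f x).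
Proof. exact (ex_RInt_scal (V := R_NormedModule) f 0 1 c). Qed.

Lemma I01_scal (c : R) (f : R -> R) : ex01 f -> I01 (fun x => c * f x) = c * I01 f.
Proof. exact (RInt_scal (V := R_CompleteNormedModule) f 0 1 c). Qed.

Lemma ex01_minus (f g : R -> R) : ex01 f -> ex01 g -> ex01 (fun x => f x - g x).
Proof. exact (ex_RInt_minus (V := R_NormedModule) f g 0 1). Qed.

Lemma I01_minus (f g : R -> R) :
  ex01 f -> ex01 g -> I01 (fun x => f x - g x) = I01 f - I01 g.
Proof. exact (RInt_minus (V := R_CompleteNormedModule) f g 0 1). Qed.

Lemma ex01_const (c : R) : ex01 (fun _ => c).
Proof. exact (ex_RInt_const (V := R_NormedModule) 0 1 c). Qed.

Lemma I01_const (c : R) : I01 (fun _ => c) = c.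
Proof.
unfold I01; rewrite (RInt_const (V := R_CompleteNormedModule)).
unfold scal; simpl; unfold mult; simpl; ring.
Qed.

Lemma ex01_reflect (f : R -> R) : ex01 f -> ex01 (fun x => f (1 - x)).
Proof.
intros [l H].
(* The substitution x -> 1 - x reverses the end points; the sign from swapping them cancels the
   slope -1. *)
assert (H' : is_RInt (V := R_NormedModule) f (-1 * 0 + 1) (-1 * 1 + 1) (opp l)).
{ replace (-1 * 0 + 1) with 1 by ring; replace (-1 * 1 + 1) with 0 by ring.
  now apply @is_RInt_swap. }
apply (is_RInt_comp_lin (V := R_NormedModule)) in H'.
exists (opp (opp l)).
apply (is_RInt_ext (V := R_NormedModule) (fun y => opp (scal (-1) (f (-1 * y + 1))))).
- intros x _; unfold scal, opp; simpl; unfold mult; simpl.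
  replace (-1 * x + 1) with (1 - x) by ring; ring.
- now apply @is_RInt_opp.
Qed.

Lemma I01_reflect (f : R -> R) : ex01 f -> I01 (fun x => f (1 - x)) = I01 f.
Proof.
intros H; apply I01_unique; apply is_RInt_I01 in H; revert H; generalize (I01 f); intros l H.
assert (H' : is_RInt (V := R_NormedModule) f (-1 * 0 + 1) (-1 * 1 + 1) (opp l)).
{ replace (-1 * 0 + 1) with 1 by ring; replace (-1 * 1 + 1) with 0 by ring.
  now apply @is_RInt_swap. }
apply (is_RInt_comp_lin (V := R_NormedModule)) in H'.
replace l with (opp (opp l)) by (unfold opp; simpl; ring).
apply (is_RInt_ext (V := R_NormedModule) (fun y => opp (scal (-1) (f (-1 * y + 1))))).
- intros x _; unfold scal, opp; simpl; unfold mult; simpl.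
  replace (-1 * x + 1) with (1 - x) by ring; ring.
- now apply @is_RInt_opp.
Qed.

Lemma I01_abs_le (f : R -> R) (m : R) :
  ex01 f -> (forall x, 0 <= x <= 1 -> Rabs (f x) <= m) -> Rabs (I01 f) <= m.
Proof.
intros H B.
replace m with ((1 - 0) * m) by ring.
apply (abs_RInt_le_const f 0 1 m); [lra|exact H|].
intros; apply B; lra.
Qed.

Lemma ex01_bounded (f : R -> R) : ex01 f ->
  exists m, forall x, 0 <= x <= 1 -> Rabs (f x) <= m.
Proof.
intros H; destruct (ex_RInt_ub f 0 1 H) as [m Hm].
rewrite Rmin_left, Rmax_right in Hm by lra.
exists m; exact Hm.
Qed.

(** * Continuity on [0,1] and uniform limits *)

Definition clamp (x : R) : R := Rmax 0 (Rmin 1 x).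

Lemma clamp_bounds (x : R) : 0 <= clamp x <= 1.
Proof. unfold clamp, Rmax, Rmin; repeat destruct Rle_dec; lra. Qed.

Lemma clamp_id (x : R) : 0 <= x <= 1 -> clamp x = x.
Proof. unfold clamp, Rmax, Rmin; repeat destruct Rle_dec; lra. Qed.

Lemma clamp_lipschitz (x y : R) : Rabs (clamp x - clamp y) <= Rabs (x - y).
Proof.
unfold clamp, Rmax, Rmin, Rabs; repeat destruct Rle_dec; repeat destruct Rcase_abs; lra.
Qed.

(* Continuity on [0,1], phrased with the retraction onto [0,1] so that one-sided
   limits at the end points need no separate treatment. *)
Definition cont01 (f : R -> R) : Prop := forall x, continuous (fun y => f (clamp y)) x.

Lemma continuous_clamp (x : R) : continuous clamp x.
Proof.
intros P [eps HP]; exists eps; intros y Hy; apply HP.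
eapply Rle_lt_trans; [apply clamp_lipschitz|exact Hy].
Qed.

Lemma cont01_continuous (f : R -> R) :
  (forall x, 0 <= x <= 1 -> continuous f x) -> cont01 f.
Proof.
intros H x; apply continuous_comp; [apply continuous_clamp|apply H, clamp_bounds].
Qed.

Lemma cont01_const (c : R) : cont01 (fun _ => c).
Proof. intros x; apply continuous_const. Qed.

Lemma cont01_pow (n : nat) : cont01 (fun x => x ^ n).
Proof.
apply cont01_continuous; intros; apply @ex_derive_continuous; auto_derive; easy.
Qed.

Lemma cont01_plus (f g : R -> R) : cont01 f -> cont01 g -> cont01 (fun x => f x + g x).
Proof. intros Hf Hg x; exact (continuous_plus _ _ x (Hf x) (Hg x)). Qed.

Lemma cont01_minus (f g : R -> R) : cont01 f -> cont01 g -> cont01 (fun x => f x - g x).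
Proof. intros Hf Hg x; exact (continuous_minus _ _ x (Hf x) (Hg x)). Qed.

Lemma cont01_mult (f g : R -> R) : cont01 f -> cont01 g -> cont01 (fun x => f x * g x).
Proof. intros Hf Hg x; exact (continuous_mult _ _ x (Hf x) (Hg x)). Qed.

Lemma cont01_scal (c : R) (f : R -> R) : cont01 f -> cont01 (fun x => c * f x).
Proof. intros; now apply cont01_mult; [apply cont01_const|]. Qed.

Lemma cont01_ext (f g : R -> R) :
  (forall x, 0 <= x <= 1 -> f x = g x) -> cont01 f -> cont01 g.
Proof.
intros H Hf x. apply (continuous_ext (fun y => f (clamp y))); [|apply Hf].
intros; apply H, clamp_bounds.
Qed.

Lemma cont01_ex01 (f : R -> R) : cont01 f -> ex01 f.
Proof.
intros H; apply (ex01_ext (fun x => f (clamp x))).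
- intros; now rewrite clamp_id.
- apply (ex_RInt_continuous (V := R_CompleteNormedModule)); intros; apply H.
Qed.

Lemma cont01_bounded (f : R -> R) : cont01 f ->
  exists m, forall x, 0 <= x <= 1 -> Rabs (f x) <= m.
Proof. intros; now apply ex01_bounded, cont01_ex01. Qed.

Definition unif01 (u : nat -> R -> R) (f : R -> R) : Prop :=
  forall eps, 0 < eps -> exists N : nat, forall n : nat, (N <= n)%nat ->
    forall x, 0 <= x <= 1 -> Rabs (u n x - f x) < eps.

Lemma cont01_unif (u : nat -> R -> R) (f : R -> R) :
  (forall n, cont01 (u n)) -> unif01 u f -> cont01 f.
Proof.
intros Hu Hf x P [eps HP].
assert (He : 0 < eps / 3) by (destruct eps; simpl; lra).
destruct (Hf _ He) as [N HN].
destruct (Hu N x (ball (u N (clamp x)) (eps / 3))) as [d Hd].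
{ exists (mkposreal _ He); intros; assumption. }
exists d; intros y Hy; apply HP.
specialize (Hd y Hy).
assert (H1 := HN N (Nat.le_refl N) _ (clamp_bounds x)).
assert (H2 := HN N (Nat.le_refl N) _ (clamp_bounds y)).
change (Rabs (u N (clamp y) - u N (clamp x)) < eps / 3) in Hd.
change (Rabs (f (clamp y) - f (clamp x)) < eps).
revert Hd H1 H2; unfold Rabs; repeat destruct Rcase_abs; lra.
Qed.

Lemma I01_unif (u : nat -> R -> R) (f : R -> R) :
  (forall n, cont01 (u n)) -> unif01 u f -> is_lim_seq (fun n => I01 (u n)) (I01 f).
Proof.
intros Hu Hf. assert (Cf := cont01_unif u f Hu Hf).
apply is_lim_seq_spec; intros eps.
assert (He : 0 < eps / 2) by (destruct eps; simpl; lra).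
destruct (Hf _ He) as [N HN]; exists N; intros n Hn.
rewrite <- I01_minus by now apply cont01_ex01.
apply Rle_lt_trans with (eps / 2); [|lra].
apply I01_abs_le; [now apply ex01_minus; apply cont01_ex01|].
intros; apply Rlt_le; now apply HN.
Qed.

(** * Shifted Legendre polynomials *)

Lemma peval_padd (p q : list R) (x : R) :
  peval (padd p q) x = peval p x + peval q x.
Proof.
revert q; induction p as [|a p IH]; intros q.
- simpl; ring.
- destruct q as [|b q]; simpl; [ring|].
  change (a + b + x * peval (padd p q) x = a + x * peval p x + (b + x * peval q x)).
  rewrite IH; ring.
Qed.

Lemma peval_pscale (c : R) (p : list R) (x : R) :
  peval (pscale c p) x = c * peval p x.
Proof.
induction p as [|a p IH]; [simpl; ring|].
change (c * a + x * peval (pscale c p) x = c * (a + x * peval p x)).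
rewrite IH; ring.
Qed.

Lemma peval_pmul (p q : list R) (x : R) :
  peval (pmul p q) x = peval p x * peval q x.
Proof.
induction p as [|a p IH]; [simpl; ring|].
change (peval (padd (pscale a q) (0 :: pmul p q)) x = (a + x * peval p x) * peval q x).
rewrite peval_padd, peval_pscale.
change (peval (0 :: pmul p q) x) with (0 + x * peval (pmul p q) x).
rewrite IH; ring.
Qed.

Lemma peval_ppow (p : list R) (k : nat) (x : R) :
  peval (ppow p k) x = peval p x ^ k.
Proof.
induction k as [|k IH]; [simpl; ring|].
change (peval (pmul p (ppow p k)) x = peval p x * peval p x ^ k).
now rewrite peval_pmul, IH.
Qed.

Lemma peval_pderiv_aux (n : nat) (p : list R) (x : R) :
  peval (pderiv_aux n p) x = INR n * peval p x + x * peval (pderiv p) x.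
Proof.
revert n; induction p as [|a p IH]; intros n; [simpl; ring|].
change (INR n * a + x * peval (pderiv_aux (S n) p) x
        = INR n * (a + x * peval p x) + x * peval (pderiv_aux 1 p) x).
rewrite (IH (S n)), (IH 1%nat), S_INR; simpl INR; ring.
Qed.

Lemma is_derive_peval (p : list R) (x : R) :
  is_derive (peval p) x (peval (pderiv p) x).
Proof.
induction p as [|a p IH].
- apply (is_derive_ext (fun _ => 0)); [reflexivity|].
  apply @is_derive_const.
- apply (is_derive_ext (fun y => a + y * peval p y)); [reflexivity|].
  change (peval (pderiv (a :: p)) x) with (peval (pderiv_aux 1 p) x).
  rewrite peval_pderiv_aux.
  auto_derive.
  + exists (peval (pderiv p) x); exact IH.
  + replace (Derive (fun y => peval p y) x) with (peval (pderiv p) x).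
    * simpl; ring.
    * symmetry; apply is_derive_unique, IH.
Qed.

Lemma continuous_peval (p : list R) (x : R) : continuous (peval p) x.
Proof. apply @ex_derive_continuous; eexists; apply is_derive_peval. Qed.

Lemma I01_by_parts (p q p' q' : R -> R) :
  (forall x, is_derive p x (p' x)) -> (forall x, is_derive q x (q' x)) ->
  (forall x, continuous p' x) -> (forall x, continuous q' x) ->
  p 0 = 0 -> p 1 = 0 ->
  I01 (fun x => p' x * q x) = - I01 (fun x => p x * q' x).
Proof.
intros Hp Hq Cp Cq H0 H1.
assert (Cp0 : forall x, continuous p x)
  by (intros; apply @ex_derive_continuous; eexists; apply Hp).
assert (Cq0 : forall x, continuous q x)
  by (intros; apply @ex_derive_continuous; eexists; apply Hq).
assert (X1 : ex01 (fun x => p' x * q x)).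
{ apply cont01_ex01, cont01_mult; apply cont01_continuous; auto. }
assert (X2 : ex01 (fun x => p x * q' x)).
{ apply cont01_ex01, cont01_mult; apply cont01_continuous; auto. }
assert (H : is_RInt (V := R_NormedModule) (fun x => p' x * q x + p x * q' x) 0 1
              (p 1 * q 1 - p 0 * q 0)).
{ apply (is_RInt_derive (V := R_CompleteNormedModule) (fun x => p x * q x)).
  - intros x _. apply (is_derive_mult p q); [apply Hp|apply Hq|intros; apply Rmult_comm].
  - intros x _. apply (continuous_plus (V := R_NormedModule) (fun x => p' x * q x));
      now apply @continuous_mult. }
apply I01_unique in H; rewrite I01_plus in H by assumption.
rewrite H0, H1 in H; lra.
Qed.

(** Each differentiation lowers the multiplicity of the roots 0 and 1 of (x^2 - x)^k by at most
    one. *)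
Lemma iter_pderiv_factor (k m : nat) : (m <= k)%nat -> exists r : list R,
  forall x, peval (Nat.iter m pderiv (ppow [0; -1; 1] k)) x = (x * x - x) ^ (k - m) * peval r x.
Proof.
induction m as [|m IH]; intros Hm.
- exists [1]; intros x; simpl Nat.iter; rewrite peval_ppow, Nat.sub_0_r; simpl.
  rewrite !Rmult_0_r, !Rplus_0_r, !Rmult_1_r. f_equal. ring.
- destruct IH as [r Hr]; [lia|].
  (* The product rule with one factor x^2 - x taken out: (k - m)(2x - 1) r + (x^2 - x) r'. *)
  exists (padd (pmul (pscale (INR (k - m)) [-1; 2]) r) (pmul [0; -1; 1] (pderiv r))).
  intros x.
  rewrite peval_padd, !peval_pmul, peval_pscale.
  change (Nat.iter (S m) pderiv (ppow [0; -1; 1] k))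
    with (pderiv (Nat.iter m pderiv (ppow [0; -1; 1] k))).
  rewrite <- (is_derive_unique _ _ _ (is_derive_peval _ x)).
  rewrite (Derive_ext _ _ _ Hr).
  replace (k - m)%nat with (S (k - S m)) by lia.
  apply is_derive_unique. auto_derive.
  + eexists; apply is_derive_peval.
  + replace (Derive (fun y => peval r y) x) with (peval (pderiv r) x)
      by (symmetry; apply is_derive_unique, is_derive_peval).
    rewrite S_INR; simpl.
    replace (match (k - S m)%nat with O => 1 | S _ => INR (k - S m) + 1 end)
      with (INR (k - S m) + 1) by (destruct (k - S m)%nat; simpl; ring).
    change (x * x + - x) with (x * x - x).
    generalize ((x * x - x) ^ (k - S m)); intros w; ring.
Qed.

(** Integration by parts moves derivatives from the Rodrigues factor onto x^b, which is exhausted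
    after b + 1 <= m steps. The boundary terms vanish because fewer than k derivatives of (x^2 -
    x)^k still vanish at 0 and 1. *)
Lemma I01_iter_pderiv (k b m : nat) : (b < m <= k)%nat ->
  I01 (fun x => peval (Nat.iter m pderiv (ppow [0; -1; 1] k)) x * x ^ b) = 0.
Proof.
revert m; induction b as [|b IH]; intros [|m] Hm; try lia;
  destruct (iter_pderiv_factor k m) as [r Hr]; try lia;
  (assert (Z : forall x, x * x - x = 0 -> peval (Nat.iter m pderiv (ppow [0; -1; 1] k)) x = 0);
   [ intros x Hx; rewrite Hr; replace (k - m)%nat with (S (k - S m)) by lia;
     rewrite Hx; simpl; ring | ]);
  change (Nat.iter (S m) pderiv (ppow [0; -1; 1] k))
    with (pderiv (Nat.iter m pderiv (ppow [0; -1; 1] k))).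
- rewrite (I01_by_parts (peval (Nat.iter m pderiv (ppow [0; -1; 1] k))) _ _ (fun _ => 0)).
  + rewrite (I01_ext _ (fun _ => 0)), I01_const by (intros; ring); ring.
  + intros; apply is_derive_peval.
  + intros x; simpl; apply @is_derive_const.
  + intros; apply continuous_peval.
  + intros; apply continuous_const.
  + apply Z; ring.
  + apply Z; ring.
- rewrite (I01_by_parts (peval (Nat.iter m pderiv (ppow [0; -1; 1] k))) _ _
             (fun x => INR (S b) * x ^ b)).
  + rewrite (I01_ext _ (fun x => INR (S b) *
        (peval (Nat.iter m pderiv (ppow [0; -1; 1] k)) x * x ^ b))) by (intros; ring).
    rewrite I01_scal, IH by (lia || (apply cont01_ex01, cont01_mult;
      [apply cont01_continuous; intros; apply continuous_peval|apply cont01_pow])).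
    ring.
  + intros; apply is_derive_peval.
  + intros x. replace (INR (S b) * x ^ b) with (INR (S b) * 1 * x ^ pred (S b))
      by (cbn [pred]; ring).
    apply (is_derive_pow (fun y => y)), @is_derive_id.
  + intros; apply continuous_peval.
  + intros; apply @ex_derive_continuous; auto_derive; easy.
  + apply Z; ring.
  + apply Z; ring.
Qed.

Lemma continuous_shleg (k : nat) (x : R) : continuous (shleg k) x.
Proof.
apply (@continuous_mult R_UniformSpace R_AbsRing); [apply continuous_const|apply continuous_peval].
Qed.

Lemma cont01_shleg (k : nat) : cont01 (shleg k).
Proof. apply cont01_continuous; intros; apply continuous_shleg. Qed.

Lemma I01_shleg_pow (k b : nat) : (b < k)%nat -> I01 (fun x => shleg k x * x ^ b) = 0.
Proof.
intros H; unfold shleg; set (c := _ / _).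
rewrite (I01_ext _ (fun x => c * (peval (Nat.iter k pderiv (ppow [0; -1; 1] k)) x * x ^ b)))
  by (intros; ring).
rewrite I01_scal, I01_iter_pderiv by (lia || (apply cont01_ex01, cont01_mult;
  [apply cont01_continuous; intros; apply continuous_peval|apply cont01_pow])).
ring.
Qed.

(** x^2 - x is invariant under x -> 1 - x, and each of the k derivatives contributes a factor -1. *)
Lemma shleg_reflect (k : nat) (x : R) : shleg k (1 - x) = (-1) ^ k * shleg k x.
Proof.
unfold shleg.
assert (H : forall m y, peval (Nat.iter m pderiv (ppow [0; -1; 1] k)) (1 - y)
   = (-1) ^ m * peval (Nat.iter m pderiv (ppow [0; -1; 1] k)) y).
{ induction m as [|m IH]; intros y.
  - simpl Nat.iter; rewrite !peval_ppow.
    replace (peval [0; -1; 1] (1 - y)) with (peval [0; -1; 1] y) by (simpl; ring).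
    simpl; ring.
  - set (p := Nat.iter m pderiv (ppow [0; -1; 1] k)) in *.
    change (Nat.iter (S m) pderiv (ppow [0; -1; 1] k)) with (pderiv p).
    (* The same derivative computed by the chain rule and by the induction hypothesis; uniqueness
       gives the next sign. *)
    assert (D1 : is_derive (fun z => peval p (1 - z)) y (- peval (pderiv p) (1 - y))).
    { replace (- peval (pderiv p) (1 - y)) with (-1 * peval (pderiv p) (1 - y)) by ring.
      apply (is_derive_comp (peval p) (fun z => 1 - z)); [apply is_derive_peval|].
      auto_derive; [easy|ring]. }
    assert (D2 : is_derive (fun z => peval p (1 - z)) y ((-1) ^ m * peval (pderiv p) y)).
    { apply (is_derive_ext (fun z => (-1) ^ m * peval p z)); [intros; now rewrite IH|].
      apply is_derive_scal, is_derive_peval. }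
    apply is_derive_unique in D1. apply is_derive_unique in D2. simpl. lra. }
rewrite H; ring.
Qed.

Lemma shleg_0 (x : R) : shleg 0 x = 1.
Proof. unfold shleg; simpl. rewrite sqrt_1; field. Qed.

Lemma shleg_1 (x : R) : shleg 1 x = sqrt 3 * (2 * x - 1).
Proof.
unfold shleg; simpl. replace (1 + 1 + 1) with 3 by ring. field.
Qed.

Lemma shleg_2 (x : R) : shleg 2 x = sqrt 5 * (6 * x ^ 2 - 6 * x + 1).
Proof.
unfold shleg; simpl. replace (1 + 1 + 1 + 1 + 1) with 5 by ring. field.
Qed.

(** * The kernel *)

Lemma I01_antiderivative (G g : R -> R) :
  (forall x, is_derive G x (g x)) -> (forall x, continuous g x) -> I01 g = G 1 - G 0.
Proof.
intros HG Hg; apply I01_unique, (is_RInt_derive (V := R_CompleteNormedModule)); auto.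
Qed.

Lemma fsum_ext (n : nat) (f g : nat -> R) :
  (forall k, (k < n)%nat -> f k = g k) -> fsum n f = fsum n g.
Proof.
induction n as [|n IH]; intros H; simpl; [easy|].
rewrite H, IH by auto with arith; easy.
Qed.

Lemma fsum_plus (n : nat) (f g : nat -> R) :
  fsum n (fun k => f k + g k) = fsum n f + fsum n g.
Proof. induction n as [|n IH]; simpl; [ring|rewrite IH; ring]. Qed.

Lemma fsum_scal (n : nat) (c : R) (f : nat -> R) :
  fsum n (fun k => c * f k) = c * fsum n f.
Proof. induction n as [|n IH]; simpl; [ring|rewrite IH; ring]. Qed.

Lemma fsum_zero (n : nat) (f : nat -> R) :
  (forall k, (k < n)%nat -> f k = 0) -> fsum n f = 0.
Proof.
induction n as [|n IH]; intros H; simpl; [easy|].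
rewrite H, IH by auto with arith; ring.
Qed.

Lemma fsum_stable (m n : nat) (f : nat -> R) : (m <= n)%nat ->
  (forall k, (m <= k)%nat -> f k = 0) -> fsum n f = fsum m f.
Proof.
intros Hmn H; induction Hmn as [|n Hmn IH]; simpl; [easy|].
rewrite IH, H by assumption; ring.
Qed.

Lemma cont01_fsum (n : nat) (f : nat -> R -> R) :
  (forall k, cont01 (f k)) -> cont01 (fun x => fsum n (fun k => f k x)).
Proof.
intros H; induction n as [|n IH]; simpl; [apply cont01_const|now apply cont01_plus].
Qed.

Lemma I01_fsum (n : nat) (f : nat -> R -> R) :
  (forall k, cont01 (f k)) -> I01 (fun x => fsum n (fun k => f k x)) = fsum n (fun k => I01 (f k)).
Proof.
intros H; induction n as [|n IH]; simpl; [apply I01_const|].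
rewrite I01_plus, IH; [easy| |]; apply cont01_ex01; [now apply cont01_fsum|easy].
Qed.

Definition bounded2 (F : R -> R -> R) : Prop :=
  exists m, forall x y, 0 <= x <= 1 -> 0 <= y <= 1 -> Rabs (F x y) <= m.

Lemma bounded2_plus (F G : R -> R -> R) :
  bounded2 F -> bounded2 G -> bounded2 (fun x y => F x y + G x y).
Proof.
intros [m Hm] [m' Hm']; exists (m + m'); intros x y Hx Hy.
eapply Rle_trans; [apply Rabs_triang|]; now apply Rplus_le_compat; [apply Hm|apply Hm'].
Qed.

Lemma bounded2_fsum (n : nat) (F : nat -> R -> R -> R) :
  (forall k, bounded2 (F k)) -> bounded2 (fun x y => fsum n (fun k => F k x y)).
Proof.
intros H; induction n as [|n IH]; simpl.
- exists 0; intros; rewrite Rabs_R0; lra.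
- now apply bounded2_plus.
Qed.

Lemma bounded2_prod (c : R) (f g : R -> R) :
  cont01 f -> cont01 g -> bounded2 (fun x y => c * f x * g y).
Proof.
intros Hf Hg. destruct (cont01_bounded f Hf) as [m Hm], (cont01_bounded g Hg) as [m' Hm'].
exists (Rabs c * m * m'); intros x y Hx Hy; rewrite !Rabs_mult.
apply Rmult_le_compat; auto using Rabs_pos, Rmult_le_pos.
apply Rmult_le_compat; auto using Rabs_pos, Rle_refl.
Qed.

(* Coefficients of the kernel with respect to the products P_i(tau) P_j(sigma). *)
Definition acoef (alpha : nat -> nat -> R) (i j : nat) : R :=
  if (Nat.even (i + j) && Nat.ltb 1 (i + j))%bool then alpha i j else
  match i, j with
  | 0%nat, 0%nat => alpha 0%nat 0%nat
  | 0%nat, 1%nat => - / 2 * xi1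
  | 1%nat, 0%nat => / 2 * xi1
  | _, _ => 0
  end.

Definition Asum (alpha : nat -> nat -> R) (n : nat) (tau sigma : R) : R :=
  fsum n (fun i => fsum n (fun j => acoef alpha i j * shleg i tau * shleg j sigma)).

(** Absorbs the three terms of [Abar_base] into one double sum; they involve P_0 and P_1, which a
    truncation contains only from n = 2 on. *)
Lemma Asum_eq (alpha : nat -> nat -> R) (n : nat) (tau sigma : R) : (2 <= n)%nat ->
  Abar_base alpha tau sigma + Abar_psum alpha n tau sigma = Asum alpha n tau sigma.
Proof.
intros Hn; unfold Asum, Abar_psum.
(* [b] keeps the terms outside the even part; only (0,0), (0,1) and (1,0) can be nonzero. *)
set (b := fun i j => (if (Nat.even (i + j) && Nat.ltb 1 (i + j))%bool then 0 else acoef alpha i j)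
                      * shleg i tau * shleg j sigma).
transitivity (fsum n (fun i => fsum n (fun j => b i j)) + Abar_psum alpha n tau sigma).
- f_equal.
  rewrite (fsum_stable 2 n) by (assumption || (intros i Hi; apply fsum_zero; intros j _;
    unfold b, acoef; destruct (Nat.even (i + j) && Nat.ltb 1 (i + j))%bool; [ring|];
    destruct i as [|[|i]]; [lia|lia|ring])).
  assert (H : forall i, fsum n (fun j => b i j) = fsum 2 (fun j => b i j)).
  { intros i; apply fsum_stable; [assumption|]; intros j Hj; unfold b, acoef.
    destruct (Nat.even (i + j) && Nat.ltb 1 (i + j))%bool; [ring|].
    destruct j as [|[|j]]; [lia|lia|]; destruct i as [|[|i]]; simpl; ring. }
  rewrite (fsum_ext _ _ _ (fun i _ => H i)). unfold b, acoef, Abar_base; simpl; rewrite !shleg_0.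
  ring.
- unfold Abar_psum; rewrite <- fsum_plus; apply fsum_ext; intros i _.
  rewrite <- fsum_plus; apply fsum_ext; intros j _.
  unfold b, acoef; destruct (Nat.even (i + j) && Nat.ltb 1 (i + j))%bool; ring.
Qed.

(** Uniform convergence of the square partial sums on [0,1]^2. A coefficient family with finitely
    many nonzero entries is the case where the sums become stationary. *)
Definition legendre_kernel (alpha : nat -> nat -> R) (Abar : R -> R -> R) : Prop :=
  forall eps, 0 < eps -> exists N : nat, forall n : nat, (N <= n)%nat ->
    forall tau sigma, 0 <= tau <= 1 -> 0 <= sigma <= 1 ->
      Rabs (Abar_base alpha tau sigma + Abar_psum alpha n tau sigma - Abar tau sigma) < eps.

Lemma Asum_unif (alpha : nat -> nat -> R) (Abar : R -> R -> R) :
  legendre_kernel alpha Abar ->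
  forall eps, 0 < eps -> exists N : nat, forall n : nat, (N <= n)%nat ->
    forall tau sigma, 0 <= tau <= 1 -> 0 <= sigma <= 1 ->
      Rabs (Asum alpha n tau sigma - Abar tau sigma) < eps.
Proof.
intros H eps He; destruct (H eps He) as [N HN]; exists (max N 2); intros n Hn tau sigma Ht Hs.
rewrite <- Asum_eq by lia; apply HN; [lia|assumption|assumption].
Qed.

Lemma xi1_eq : xi1 = sqrt 3 / 6.
Proof.
assert (H : sqrt 3 * sqrt 3 = 3) by (apply sqrt_sqrt; lra).
assert (0 < sqrt 3) by (apply sqrt_lt_R0; lra).
unfold xi1; field_simplify_eq; [|lra]; ring [H].
Qed.

(** With the given [xi1] the base part is alpha(0,0) + (tau - sigma)/2, from which the correction
    term can be read off. *)
Lemma Abar_base_reflect (alpha : nat -> nat -> R) (tau sigma : R) :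
  Abar_base alpha (1 - tau) sigma = Abar_base alpha tau (1 - sigma) + (1 - sigma - tau).
Proof.
assert (H : sqrt 3 * sqrt 3 = 3) by (apply sqrt_sqrt; lra).
unfold Abar_base; rewrite xi1_eq, !shleg_1; field [H].
Qed.

(** Reflecting tau gives the sign (-1)^i, reflecting sigma gives (-1)^j; they agree because i + j is
    even. *)
Lemma Abar_psum_reflect (alpha : nat -> nat -> R) (n : nat) (tau sigma : R) :
  Abar_psum alpha n (1 - tau) sigma = Abar_psum alpha n tau (1 - sigma).
Proof.
apply fsum_ext; intros i _; apply fsum_ext; intros j _.
destruct (Nat.even (i + j)) eqn:E; [|easy]; destruct (Nat.ltb 1 (i + j)); [simpl|easy].
rewrite !shleg_reflect.
replace ((-1) ^ j) with ((-1) ^ i); [ring|].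
apply Nat.even_spec in E; destruct E as [m Hm].
assert (S : (-1) ^ i * (-1) ^ j = 1) by (rewrite <- pow_add, Hm; apply pow_1_even).
assert (A : (-1) ^ i = 1 \/ (-1) ^ i = -1)
  by (clear; induction i as [|i [IH|IH]]; simpl; [lra| |]; rewrite IH; lra).
destruct A as [A|A]; rewrite A in *; lra.
Qed.

(** The identity holds for every partial sum and survives the limit: both sides lie within less than
    half their supposed distance of the same partial sum. *)
Lemma kernel_reflect (alpha : nat -> nat -> R) (Abar : R -> R -> R) (tau sigma : R) :
  legendre_kernel alpha Abar -> 0 <= tau <= 1 -> 0 <= sigma <= 1 ->
  Abar (1 - tau) sigma = Abar tau (1 - sigma) + (1 - sigma - tau).
Proof.
intros H Ht Hs. apply Rminus_diag_uniq.
destruct (Req_dec (Abar (1 - tau) sigma - (Abar tau (1 - sigma) + (1 - sigma - tau))) 0)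
  as [E|E]; [exact E|exfalso].
apply Rabs_pos_lt in E; revert E.
set (D := Rabs _); intros E.
destruct (H (D / 2) ltac:(lra)) as [N HN]; specialize (HN N (Nat.le_refl N)).
assert (H1 := HN (1 - tau) sigma ltac:(lra) Hs).
assert (H2 := HN tau (1 - sigma) Ht ltac:(lra)).
rewrite Abar_base_reflect, Abar_psum_reflect in H1.
revert H1 H2 E; unfold D, Rabs; repeat destruct Rcase_abs; lra.
Qed.

Lemma cont01_Asum (alpha : nat -> nat -> R) (n : nat) (tau : R) : cont01 (Asum alpha n tau).
Proof.
apply cont01_fsum; intros i; apply cont01_fsum; intros j; apply cont01_scal, cont01_shleg.
Qed.

Lemma cont01_kernel (alpha : nat -> nat -> R) (Abar : R -> R -> R) (tau : R) :
  legendre_kernel alpha Abar -> 0 <= tau <= 1 -> cont01 (Abar tau).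
Proof.
intros H Ht; apply (cont01_unif (fun n => Asum alpha n tau)); [intros; apply cont01_Asum|].
intros eps He; destruct (Asum_unif alpha Abar H eps He) as [N HN].
exists N; intros; now apply HN.
Qed.

(** The kernel stays within 1 of a truncation, which is a finite sum of products of continuous
    functions. *)
Lemma kernel_bounded (alpha : nat -> nat -> R) (Abar : R -> R -> R) :
  legendre_kernel alpha Abar -> bounded2 Abar.
Proof.
intros H; destruct (Asum_unif alpha Abar H 1 Rlt_0_1) as [N HN].
destruct (bounded2_fsum N (fun i x y => fsum N (fun j => acoef alpha i j * shleg i x * shleg j y)))
  as [m Hm].
{ intros i; apply bounded2_fsum; intros j; apply bounded2_prod; apply cont01_shleg. }
exists (m + 1); intros x y Hx Hy.
specialize (HN N (Nat.le_refl N) x y Hx Hy); specialize (Hm x y Hx Hy); fold (Asum alpha N x y) in Hm.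
revert HN Hm; unfold Rabs; repeat destruct Rcase_abs; lra.
Qed.

Definition Aop (Abar : R -> R -> R) (psi : R -> R) (tau : R) : R :=
  I01 (fun sigma => Abar tau sigma * psi sigma).

(** Truncated kernels give operators of finite rank, so applying one yields a combination of P_i
    whose coefficients are Legendre moments of [psi]. *)
Lemma Aop_Asum (alpha : nat -> nat -> R) (n : nat) (psi : R -> R) (tau : R) : cont01 psi ->
  Aop (Asum alpha n) psi tau =
  fsum n (fun i => fsum n (fun j => acoef alpha i j * I01 (fun x => shleg j x * psi x)) * shleg i tau).
Proof.
intros Hpsi; unfold Aop, Asum.
rewrite (I01_ext _ (fun x => fsum n (fun i => shleg i tau * fsum n (fun j =>
   acoef alpha i j * (shleg j x * psi x))))).
- rewrite I01_fsum.
  + apply fsum_ext; intros i _.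
    rewrite I01_scal, I01_fsum, Rmult_comm.
    * f_equal; apply fsum_ext; intros j _; apply I01_scal, cont01_ex01, cont01_mult;
        [apply cont01_shleg|assumption].
    * intros; apply cont01_scal, cont01_mult; [apply cont01_shleg|assumption].
    * apply cont01_ex01, cont01_fsum; intros; apply cont01_scal, cont01_mult;
        [apply cont01_shleg|assumption].
  + intros; apply cont01_scal, cont01_fsum; intros; apply cont01_scal, cont01_mult;
        [apply cont01_shleg|assumption].
- intros x _; rewrite Rmult_comm, <- fsum_scal; apply fsum_ext; intros i _.
  rewrite <- !fsum_scal; apply fsum_ext; intros j _; ring.
Qed.

Lemma Aop_Asum_unif (alpha : nat -> nat -> R) (Abar : R -> R -> R) (psi : R -> R) :
  legendre_kernel alpha Abar -> cont01 psi ->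
  unif01 (fun n => Aop (Asum alpha n) psi) (Aop Abar psi).
Proof.
intros H Hpsi eps He.
destruct (cont01_bounded psi Hpsi) as [m Hm].
assert (Hm0 : 0 <= m) by (eapply Rle_trans; [apply Rabs_pos|apply (Hm 0); lra]).
assert (Hd : 0 < eps / (2 * (m + 1))) by (apply Rdiv_lt_0_compat; lra).
destruct (Asum_unif alpha Abar H _ Hd) as [N HN]; exists N; intros n Hn tau Ht.
unfold Aop; rewrite <- I01_minus; try apply cont01_ex01, cont01_mult; try assumption;
  [|apply cont01_Asum|now apply (cont01_kernel alpha)].
apply Rle_lt_trans with (eps / 2); [|lra].
apply I01_abs_le.
- apply ex01_minus; apply cont01_ex01, cont01_mult; try assumption;
  [apply cont01_Asum|now apply (cont01_kernel alpha)].
- intros x Hx. specialize (HN n Hn tau x Ht Hx); specialize (Hm x Hx).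
  rewrite <- Rmult_minus_distr_r, Rabs_mult.
  replace (eps / 2) with (eps / (2 * (m + 1)) * (m + 1)) by (field; lra).
  apply Rmult_le_compat; try apply Rabs_pos; lra.
Qed.

Lemma cont01_Aop_Asum (alpha : nat -> nat -> R) (n : nat) (psi : R -> R) :
  cont01 psi -> cont01 (Aop (Asum alpha n) psi).
Proof.
intros Hpsi.
apply (cont01_ext _ _ (fun tau _ => eq_sym (Aop_Asum alpha n psi tau Hpsi))).
apply cont01_fsum; intros; apply cont01_scal, cont01_shleg.
Qed.

(** Continuity in tau comes from the uniform limit of the finite-rank operators, so joint continuity
    of the kernel never has to be stated. *)
Lemma cont01_Aop (alpha : nat -> nat -> R) (Abar : R -> R -> R) (psi : R -> R) :
  legendre_kernel alpha Abar -> cont01 psi -> cont01 (Aop Abar psi).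
Proof.
intros H Hpsi; apply (cont01_unif (fun n => Aop (Asum alpha n) psi)); [|now apply Aop_Asum_unif].
intros; now apply cont01_Aop_Asum.
Qed.

Lemma unif01_mult (p : R -> R) (u : nat -> R -> R) (f : R -> R) :
  cont01 p -> unif01 u f -> unif01 (fun n x => p x * u n x) (fun x => p x * f x).
Proof.
intros Hp Hu eps He.
destruct (cont01_bounded p Hp) as [m Hm].
assert (Hm0 : 0 <= m) by (eapply Rle_trans; [apply Rabs_pos|apply (Hm 0); lra]).
destruct (Hu (eps / (m + 1))) as [N HN]; [apply Rdiv_lt_0_compat; lra|].
exists N; intros n Hn x Hx; specialize (HN n Hn x Hx); specialize (Hm x Hx).
rewrite <- Rmult_minus_distr_l, Rabs_mult.
replace eps with ((m + 1) * (eps / (m + 1))) by (field; lra).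
apply Rle_lt_trans with (m * Rabs (u n x - f x)).
- apply Rmult_le_compat_r; [apply Rabs_pos|assumption].
- assert (0 <= Rabs (u n x - f x)) by apply Rabs_pos. nra.
Qed.

(** The pairings of the truncated kernels with [p] and [psi] converge to the pairing of the kernel
    itself, so a value shared by all late truncations is the exact one. For low-degree polynomials
    orthogonality makes the truncations stationary. *)
Lemma pairing_lim (alpha : nat -> nat -> R) (Abar : R -> R -> R) (p psi : R -> R) (l : R) (N : nat) :
  legendre_kernel alpha Abar -> cont01 p -> cont01 psi ->
  (forall n, (N <= n)%nat ->
     fsum n (fun i => fsum n (fun j => acoef alpha i j * I01 (fun x => shleg j x * psi x))
                      * I01 (fun x => shleg i x * p x)) = l) ->
  I01 (fun x => p x * Aop Abar psi x) = l.
Proof.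
intros H Hp Hpsi Hl.
assert (L : is_lim_seq (fun n => I01 (fun x => p x * Aop (Asum alpha n) psi x))
                       (I01 (fun x => p x * Aop Abar psi x))).
{ apply (I01_unif (fun n x => p x * Aop (Asum alpha n) psi x)).
  - intros; apply cont01_mult; [assumption|now apply cont01_Aop_Asum].
  - now apply unif01_mult; [|apply Aop_Asum_unif]. }
apply is_lim_seq_unique in L.
assert (L' : is_lim_seq (fun n => I01 (fun x => p x * Aop (Asum alpha n) psi x)) l).
{ apply (is_lim_seq_ext_loc (fun _ => l)); [|apply is_lim_seq_const].
  exists N; intros n Hn; rewrite <- (Hl n Hn); symmetry.
  rewrite (I01_ext _ (fun x => fsum n (fun i => fsum n (fun j => acoef alpha i j *
     I01 (fun x => shleg j x * psi x)) * (shleg i x * p x)))).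
  - rewrite I01_fsum by (intros; apply cont01_scal, cont01_mult; [apply cont01_shleg|assumption]).
    apply fsum_ext; intros; apply I01_scal, cont01_ex01, cont01_mult; [apply cont01_shleg|assumption].
  - intros x _; rewrite Aop_Asum, <- fsum_scal by assumption.
    apply fsum_ext; intros; ring. }
apply is_lim_seq_unique in L'. rewrite L in L'. now injection L'.
Qed.

(** * Moments of the kernel *)

Lemma I01_pow (n : nat) : I01 (fun x => x ^ n) = / (INR n + 1).
Proof.
assert (0 < INR n + 1) by (generalize (pos_INR n); lra).
rewrite (I01_antiderivative (fun x => x ^ S n / (INR n + 1))).
- rewrite pow1, pow_i by lia; field; lra.
- intros x. replace (x ^ n) with (/ (INR n + 1) * (INR (S n) * 1 * x ^ pred (S n)))
    by (rewrite S_INR; cbn [pred]; field; lra).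
  apply (is_derive_ext (fun y => / (INR n + 1) * y ^ S n)).
  + intros t; unfold Rdiv; apply Rmult_comm.
  + apply is_derive_scal. apply (is_derive_pow (fun y => y)), @is_derive_id.
- intros; apply @ex_derive_continuous; auto_derive; easy.
Qed.

Lemma I01_poly2 (c0 c1 c2 : R) (b : nat) :
  I01 (fun x => (c0 + c1 * x + c2 * x ^ 2) * x ^ b)
  = c0 / (INR b + 1) + c1 / (INR b + 2) + c2 / (INR b + 3).
Proof.
assert (B := pos_INR b).
rewrite (I01_ext _ (fun x => c0 * x ^ b + (c1 * x ^ (S b) + c2 * x ^ (S (S b)))))
  by (intros; simpl; ring).
assert (H : forall c n, ex01 (fun x => c * x ^ n))
  by (intros; apply cont01_ex01, cont01_scal, cont01_pow).
rewrite !I01_plus, !I01_scal, !I01_pow, !S_INR; auto using ex01_plus, cont01_ex01, cont01_pow.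
field; lra.
Qed.

Lemma shleg_0_moment (b : nat) : I01 (fun x => shleg 0 x * x ^ b) = / (INR b + 1).
Proof.
rewrite <- I01_pow; apply I01_ext; intros; rewrite shleg_0; ring.
Qed.

Lemma shleg_1_moment (b : nat) :
  I01 (fun x => shleg 1 x * x ^ b) = sqrt 3 * (INR b / ((INR b + 1) * (INR b + 2))).
Proof.
assert (B := pos_INR b).
rewrite (I01_ext _ (fun x => (- sqrt 3 + 2 * sqrt 3 * x + 0 * x ^ 2) * x ^ b))
  by (intros; rewrite shleg_1; ring).
rewrite I01_poly2; field; lra.
Qed.

Lemma shleg_2_moment (b : nat) :
  I01 (fun x => shleg 2 x * x ^ b)
  = sqrt 5 * (INR b * (INR b - 1) / ((INR b + 1) * (INR b + 2) * (INR b + 3))).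
Proof.
assert (B := pos_INR b).
rewrite (I01_ext _ (fun x => (sqrt 5 + (- 6 * sqrt 5) * x + 6 * sqrt 5 * x ^ 2) * x ^ b))
  by (intros; rewrite shleg_2; ring).
rewrite I01_poly2; field; lra.
Qed.

(** Orthogonality removes every term with i > a or j > b, so no coefficient beyond index 3 can
    contribute for these degrees. *)
Lemma kernel_moment (alpha : nat -> nat -> R) (Abar : R -> R -> R) (a b : nat) :
  legendre_kernel alpha Abar -> (a <= 3)%nat -> (b <= 3)%nat ->
  I01 (fun x => x ^ a * Aop Abar (fun s => s ^ b) x) =
  fsum 4 (fun i => fsum 4 (fun j => acoef alpha i j * I01 (fun x => shleg j x * x ^ b))
                   * I01 (fun x => shleg i x * x ^ a)).
Proof.
intros H Ha Hb; apply (pairing_lim alpha _ _ _ _ 4); auto using cont01_pow.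
intros n Hn; rewrite (fsum_stable 4 n); [|assumption|].
- apply fsum_ext; intros i _; f_equal; apply fsum_stable; [assumption|].
  intros j Hj; rewrite (I01_shleg_pow j b) by lia; ring.
- intros i Hi; rewrite (I01_shleg_pow i a) by lia; ring.
Qed.

(* The defect of the kernel against the iterated integral
   int_0^tau (tau - s) s^k ds = tau^(k+2) / ((k+1)(k+2)). *)
Definition defect (Abar : R -> R -> R) (k : nat) (tau : R) : R :=
  Aop Abar (fun s => s ^ k) tau - tau ^ (k + 2) / ((INR k + 1) * (INR k + 2)).

Lemma cont01_defect (alpha : nat -> nat -> R) (Abar : R -> R -> R) (k : nat) :
  legendre_kernel alpha Abar -> cont01 (defect Abar k).
Proof.
intros H; apply cont01_minus; [now apply (cont01_Aop alpha); [|apply cont01_pow]|].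
apply cont01_mult; [apply cont01_pow|apply cont01_const].
Qed.

(** The required value is int tau^(a+k+2) / ((k+1)(k+2)). It is a separate argument [m] so that the
    moment can be computed by rewriting first and compared afterwards. *)
Lemma defect_moment (alpha : nat -> nat -> R) (Abar : R -> R -> R) (a k : nat) (m : R) :
  legendre_kernel alpha Abar ->
  I01 (fun x => x ^ a * Aop Abar (fun s => s ^ k) x) = m ->
  m = / (INR (a + k) + 3) / ((INR k + 1) * (INR k + 2)) ->
  I01 (fun x => x ^ a * defect Abar k x) = 0.
Proof.
intros H <- E.
assert (B := pos_INR k).
rewrite (I01_ext _ (fun x => x ^ a * Aop Abar (fun s => s ^ k) x
    - / ((INR k + 1) * (INR k + 2)) * x ^ (a + (k + 2)))).
- rewrite I01_minus, E, I01_scal, I01_pow.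
  + rewrite !plus_INR; simpl (INR 2). assert (C := pos_INR a). field; lra.
  + apply cont01_ex01, cont01_pow.
  + apply cont01_ex01, cont01_mult; [apply cont01_pow|].
    now apply (cont01_Aop alpha); [|apply cont01_pow].
  + apply cont01_ex01, cont01_scal, cont01_pow.
- intros x _; unfold defect; rewrite (pow_add x a); field; lra.
Qed.

(** Reduces a vanishing moment to an algebraic identity in sqrt 3 and sqrt 5. The pairing of P_3
    with x^3 is left unevaluated: it occurs only for a = 0, where row 0 has coefficient zero at j =
    3 and the other rows have zero moment. *)
Ltac kernel_moments H :=
  assert (S3 : sqrt 3 * sqrt 3 = 3) by (apply sqrt_sqrt; lra);
  assert (S5 : sqrt 5 * sqrt 5 = 5) by (apply sqrt_sqrt; lra);
  eapply (defect_moment _ _ _ _ _ H);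
  [ apply (kernel_moment _ _ _ _ H); lia
  | unfold fsum; rewrite !shleg_0_moment, !shleg_1_moment, !shleg_2_moment;
    rewrite ?(I01_shleg_pow 3 0), ?(I01_shleg_pow 3 1), ?(I01_shleg_pow 3 2) by lia;
    unfold acoef; simpl; rewrite ?xi1_eq ].

Ltac finish_moment :=
  match goal with S3 : _ = 3, S5 : _ = 5 |- _ =>
    revert S3 S5; generalize (sqrt 3) (sqrt 5); intros r3 r5 S3 S5;
    field_simplify_eq; nra end.

(** * Vanishing moments of the defects e_k *)

Section Defects.
Variables (alpha : nat -> nat -> R) (Abar : R -> R -> R).
Hypothesis H : legendre_kernel alpha Abar.
Hypothesis a00 : alpha 0%nat 0%nat = 1 / 6.

(** This moment is the condition that forces alpha(0,0) = 1/6. Together with the next two it covers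
    the pairs a + k <= 1 needed for order 4. *)
Lemma defect_0_0 : I01 (fun x => x ^ 0 * defect Abar 0 x) = 0.
Proof. kernel_moments H. rewrite a00; finish_moment. Qed.

Lemma defect_1_0 : I01 (fun x => x ^ 1 * defect Abar 0 x) = 0.
Proof. kernel_moments H. rewrite a00; finish_moment. Qed.

Lemma defect_0_1 : I01 (fun x => x ^ 0 * defect Abar 1 x) = 0.
Proof. kernel_moments H. rewrite a00; finish_moment. Qed.

Hypothesis a11 : alpha 1%nat 1%nat = - (1 / 10).
Hypothesis a20 : alpha 2%nat 0%nat = sqrt 5 / 60.
Hypothesis a02 : alpha 0%nat 2%nat = sqrt 5 / 60.
Hypothesis ai0 : forall i : nat, (2 < i)%nat -> Nat.even i = true -> alpha i 0%nat = 0.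

(** Here the coefficients (0,1) and (1,0) cancel and the condition reads 1/24 + alpha(1,1)/12 =
    1/30, which is where -1/10 comes from. The moments up to [defect_0_3] complete the pairs with k
    >= 1 and a + k <= 3. *)
Lemma defect_1_1 : I01 (fun x => x ^ 1 * defect Abar 1 x) = 0.
Proof. kernel_moments H. rewrite a00, a11. finish_moment. Qed.

Lemma defect_2_1 : I01 (fun x => x ^ 2 * defect Abar 1 x) = 0.
Proof. kernel_moments H. rewrite a00, a11, a20; finish_moment. Qed.

(** The origin of alpha(0,2) = sqrt 5 / 60: row 0 of the kernel must integrate s^2 to 1/60. *)
Lemma defect_0_2 : I01 (fun x => x ^ 0 * defect Abar 2 x) = 0.
Proof. kernel_moments H. rewrite a00, a02; finish_moment. Qed.

Lemma defect_1_2 : I01 (fun x => x ^ 1 * defect Abar 2 x) = 0.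
Proof. kernel_moments H. rewrite a00, a11, a02; finish_moment. Qed.

Lemma defect_0_3 : I01 (fun x => x ^ 0 * defect Abar 3 x) = 0.
Proof. kernel_moments H. rewrite a00, a02; finish_moment. Qed.

(** The column j = 0 of the coefficients is exactly the Legendre expansion of tau^2/2; this is what
    alpha(2,0) = sqrt 5 / 60 and the zeros above it encode. *)
Lemma defect_0_eq (tau : R) : 0 <= tau <= 1 -> defect Abar 0 tau = 0.
Proof.
intros Ht.
assert (S3 : sqrt 3 * sqrt 3 = 3) by (apply sqrt_sqrt; lra).
assert (S5 : sqrt 5 * sqrt 5 = 5) by (apply sqrt_sqrt; lra).
unfold defect; apply Rminus_diag_eq.
assert (L : is_lim_seq (fun n => Aop (Asum alpha n) (fun s => s ^ 0) tau)
              (Aop Abar (fun s => s ^ 0) tau)).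
{ apply is_lim_seq_spec; intros eps.
  destruct (Aop_Asum_unif alpha Abar _ H (cont01_pow 0) eps (cond_pos eps)) as [N HN].
  exists N; intros n Hn; now apply HN. }
apply is_lim_seq_unique in L.
assert (L' : is_lim_seq (fun n => Aop (Asum alpha n) (fun s => s ^ 0) tau)
              (tau ^ (0 + 2) / ((INR 0 + 1) * (INR 0 + 2)))).
{ apply (is_lim_seq_ext_loc (fun _ => tau ^ (0 + 2) / ((INR 0 + 1) * (INR 0 + 2))));
    [|apply is_lim_seq_const].
  exists 3%nat; intros n Hn; rewrite Aop_Asum by apply cont01_pow.
  (* Against the constant 1 only j = 0 contributes. *)
  assert (E : forall i, fsum n (fun j => acoef alpha i j * I01 (fun x => shleg j x * x ^ 0))
                        = acoef alpha i 0).
  { intros i; rewrite (fsum_stable 1 n) by (lia || (intros j Hj;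
      rewrite (I01_shleg_pow j 0) by lia; ring)).
    cbn [fsum]; rewrite (shleg_0_moment 0); simpl; field. }
  rewrite (fsum_ext _ _ (fun i => acoef alpha i 0 * shleg i tau))
    by (intros; now rewrite E).
  (* Rows i >= 3 drop out, the even ones by [ai0] and the odd ones by parity. *)
  rewrite (fsum_stable 3 n) by (assumption || (intros i Hi; unfold acoef;
    rewrite Nat.add_0_r; destruct (Nat.even i) eqn:Ei;
    [ rewrite (ai0 i) by (assumption || lia); destruct i as [|[|i]]; [lia|lia|];
      simpl; destruct (Nat.ltb 1 (S (S i)))%bool; ring
    | destruct i as [|[|i]]; [lia|lia|]; simpl; ring ])).
  unfold fsum, acoef; simpl; rewrite shleg_0, shleg_1, shleg_2, a00, a20, xi1_eq.
  field [S3 S5]. }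
apply is_lim_seq_unique in L'; rewrite L in L'; now injection L'.
Qed.

(** After s -> 1 - s and the reflection identity, the factor 1 - u also produces the integral of
    Abar(x,u) against 1, which e_0 = 0 evaluates to x^2/2. The rest is the explicit integral of (u -
    x)(1 - u). *)
Lemma defect_1_odd (x : R) : 0 <= x <= 1 -> defect Abar 1 (1 - x) = - defect Abar 1 x.
Proof.
intros Hx.
assert (E0 := defect_0_eq x Hx).
unfold defect in *; unfold Aop in *.
assert (Cx := cont01_kernel alpha Abar x H Hx).
assert (C : forall k, ex01 (fun s => Abar x s * s ^ k))
  by (intros; apply cont01_ex01, cont01_mult; [assumption|apply cont01_pow]).
rewrite (I01_ext _ (fun s => (fun u => Abar x u * (1 - u) + (u - x) * (1 - u)) (1 - s)))
  by (intros s Hs; cbv beta; rewrite (kernel_reflect alpha Abar x s H Hx Hs); ring).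
rewrite (I01_reflect (fun u => Abar x u * (1 - u) + (u - x) * (1 - u))).
- rewrite (I01_ext _ (fun u => Abar x u * u ^ 0 - Abar x u * u ^ 1
             + (- x + (1 + x) * u + - 1 * u ^ 2) * u ^ 0)) by (intros; ring).
  assert (Xp : ex01 (fun u => (- x + (1 + x) * u + - 1 * u ^ 2) * u ^ 0)).
  { apply cont01_ex01, cont01_mult; [|apply cont01_pow].
    apply cont01_continuous; intros; apply @ex_derive_continuous; auto_derive; easy. }
  rewrite (I01_plus _ _ (ex01_minus _ _ (C 0%nat) (C 1%nat)) Xp),
    (I01_minus _ _ (C 0%nat) (C 1%nat)), I01_poly2.
  replace (I01 (fun s => Abar x s * s ^ 0)) with (x ^ (0 + 2) / ((INR 0 + 1) * (INR 0 + 2))) by lra.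
  generalize (I01 (fun u => Abar x u * u ^ 1)); intros w. simpl; field.
- apply cont01_ex01, cont01_plus; apply cont01_mult; try assumption;
  apply cont01_continuous; intros; apply @ex_derive_continuous; auto_derive; easy.
Qed.

(* In row 0 the coefficients with j >= 2 vanish unless j is even, and then P_j is
   even about 1/2 whereas the defect is odd. *)
Lemma Aop_defect_1 : I01 (fun x => x ^ 0 * Aop Abar (defect Abar 1) x) = 0.
Proof.
assert (C1 := cont01_defect alpha Abar 1 H).
apply (pairing_lim alpha _ _ _ _ 1); auto using cont01_pow.
intros n Hn; rewrite (fsum_stable 1 n) by (assumption || (intros i Hi;
  rewrite (I01_shleg_pow i 0) by lia; ring)).
unfold fsum at 1. rewrite fsum_zero; [ring|].
intros j Hj.
destruct j as [|[|j]].
- replace (I01 _) with 0; [ring|].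
  rewrite <- defect_0_1; apply I01_ext; intros; rewrite shleg_0; ring.
- replace (I01 _) with 0; [ring|].
  transitivity (2 * sqrt 3 * I01 (fun x => x ^ 1 * defect Abar 1 x)
                - sqrt 3 * I01 (fun x => x ^ 0 * defect Abar 1 x)).
  { rewrite defect_0_1, defect_1_1; ring. }
  assert (X : forall k, ex01 (fun x => x ^ k * defect Abar 1 x))
    by (intros; apply cont01_ex01, cont01_mult; [apply cont01_pow|assumption]).
  rewrite <- !I01_scal, <- I01_minus by auto using ex01_scal.
  apply I01_ext; intros; rewrite shleg_1; ring.
- unfold acoef. destruct (Nat.even (0 + S (S j))) eqn:E; [|simpl; ring].
  replace (I01 _) with 0; [ring|].
  set (g := fun x => shleg (S (S j)) x * defect Abar 1 x).
  assert (X : ex01 g) by (apply cont01_ex01, cont01_mult; [apply cont01_shleg|assumption]).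
  assert (R : I01 g = - I01 g).
  { rewrite <- (I01_reflect g X) at 1.
    rewrite (I01_ext _ (fun x => -1 * g x)), I01_scal; [ring|assumption|].
    intros x Hx; unfold g; rewrite shleg_reflect, defect_1_odd by assumption.
    apply Nat.even_spec in E; destruct E as [m Hm].
    replace (S (S j)) with (2 * m)%nat by exact (eq_sym Hm). rewrite pow_1_even; ring. }
  lra.
Qed.

End Defects.

(** * Calculus in several variables *)

Fixpoint fins (d : nat) : list (Fin.t d) :=
  match d with
  | O => []
  | S d' => Fin.F1 :: map Fin.FS (fins d')
  end.

Lemma In_fins (d : nat) (i : Fin.t d) : In i (fins d).
Proof. induction i; simpl; [now left|right; now apply in_map]. Qed.

Lemma NoDup_fins (d : nat) : NoDup (fins d).
Proof.
induction d as [|d IH]; simpl; constructor.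
- intros H; apply in_map_iff in H; destruct H as [j [Hj _]]; discriminate.
- apply Injective_map_NoDup; [|assumption].
  intros i j; apply Fin.FS_inj.
Qed.

(** Sums run over lists so that the coordinatewise induction can handle an arbitrary set of
    coordinates; [vsum] is the full sum. *)
Definition lsum {T : Type} (l : list T) (g : T -> R) : R := fold_right (fun i a => g i + a) 0 l.
Definition vsum {d : nat} (g : Fin.t d -> R) : R := lsum (fins d) g.

Lemma lsum_ext {T : Type} (l : list T) (f g : T -> R) :
  (forall i, In i l -> f i = g i) -> lsum l f = lsum l g.
Proof.
induction l as [|a l IH]; intros H; simpl; [easy|].
rewrite H by now left. f_equal; apply IH; intros; apply H; now right.
Qed.

Lemma lsum_plus {T : Type} (l : list T) (f g : T -> R) :
  lsum l (fun i => f i + g i) = lsum l f + lsum l g.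
Proof. induction l as [|a l IH]; simpl; [ring|rewrite IH; ring]. Qed.

Lemma lsum_scal {T : Type} (l : list T) (c : R) (f : T -> R) :
  lsum l (fun i => c * f i) = c * lsum l f.
Proof. induction l as [|a l IH]; simpl; [ring|rewrite IH; ring]. Qed.

Lemma lsum_abs {T : Type} (l : list T) (f : T -> R) :
  Rabs (lsum l f) <= lsum l (fun i => Rabs (f i)).
Proof.
induction l as [|a l IH]; simpl; [rewrite Rabs_R0; lra|].
eapply Rle_trans; [apply Rabs_triang|lra].
Qed.

Lemma lsum_le {T : Type} (l : list T) (f g : T -> R) :
  (forall i, In i l -> f i <= g i) -> lsum l f <= lsum l g.
Proof.
induction l as [|a l IH]; intros H; simpl; [lra|].
apply Rplus_le_compat; [apply H; now left|apply IH; intros; apply H; now right].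
Qed.

Lemma lsum_pos {T : Type} (l : list T) (f : T -> R) : (forall i, 0 <= f i) -> 0 <= lsum l f.
Proof. induction l as [|a l IH]; intros H; simpl; [lra|generalize (H a) (IH H); lra]. Qed.

Lemma lsum_term_le {T : Type} (l : list T) (f : T -> R) (i : T) :
  (forall j, 0 <= f j) -> In i l -> f i <= lsum l f.
Proof.
induction l as [|a l IH]; intros H; simpl; [easy|]; intros [->|Hi].
- generalize (lsum_pos l f H); lra.
- generalize (IH H Hi) (H a); lra.
Qed.

Lemma vsum_term_le {d : nat} (f : Fin.t d -> R) (i : Fin.t d) :
  (forall j, 0 <= f j) -> f i <= vsum f.
Proof. intros; apply lsum_term_le; [assumption|apply In_fins]. Qed.

(** * Mean value formulas from partial derivatives *)

Lemma shift_same {d : nat} (x : Vec d) (i : Fin.t d) (s : R) : shift x i s i = x i + s.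
Proof.
unfold shift. destruct (Fin.eqb i i) eqn:E; [easy|].
rewrite (proj2 (Fin.eqb_eq d i i) eq_refl) in E; discriminate.
Qed.

Lemma shift_other {d : nat} (x : Vec d) (i j : Fin.t d) (s : R) : i <> j -> shift x i s j = x j.
Proof.
intros H; unfold shift; destruct (Fin.eqb i j) eqn:E; [|ring].
now apply Fin.eqb_eq in E.
Qed.

Lemma shift_0 {d : nat} (x : Vec d) (i : Fin.t d) : shift x i 0 = x.
Proof. apply functional_extensionality; intros j; unfold shift; destruct Fin.eqb; ring. Qed.

Lemma shift_shift {d : nat} (x : Vec d) (i : Fin.t d) (s u : R) :
  shift (shift x i s) i u = shift x i (s + u).
Proof. apply functional_extensionality; intros j; unfold shift; destruct Fin.eqb; ring. Qed.

Definition partials {d : nat} (g : Vec d -> R) (gx : Fin.t d -> Vec d -> R) : Prop :=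
  forall i x, derivable_pt_lim (fun s => g (shift x i s)) 0 (gx i x).

(** Partial derivatives are given only at shift zero; composing shifts moves the base point along
    the coordinate line. *)
Lemma is_derive_shift {d : nat} (g : Vec d -> R) (gx : Fin.t d -> Vec d -> R)
  (x : Vec d) (i : Fin.t d) (s : R) : partials g gx ->
  is_derive (fun u => g (shift x i u)) s (gx i (shift x i s)).
Proof.
intros H. apply is_derive_ext with (fun u => g (shift (shift x i s) i (u - s))).
- intros u; rewrite shift_shift; do 2 f_equal; ring.
- replace (gx i (shift x i s)) with (1 * gx i (shift x i s)) by ring.
  apply (is_derive_comp (fun w => g (shift (shift x i s) i w)) (fun u => u - s)).
  + replace (s - s) with 0 by ring. apply is_derive_Reals, H.
  + auto_derive; [easy|ring].
Qed.

Lemma mean_value (y y' : R -> R) (a b : R) :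
  (forall s, Rmin a b <= s <= Rmax a b -> is_derive y s (y' s)) ->
  exists c, Rabs (c - a) <= Rabs (b - a) /\ Rmin a b <= c <= Rmax a b /\ y b - y a = y' c * (b - a).
Proof.
intros H; destruct (MVT_gen y a b y') as [c [Hc E]].
- intros; apply H; lra.
- intros; apply continuity_pt_filterlim, @ex_derive_continuous; eexists; now apply H.
- exists c; split; [|split; assumption].
  revert Hc; unfold Rmin, Rmax, Rabs; repeat destruct Rle_dec; repeat destruct Rcase_abs; lra.
Qed.

Lemma mean_value_shift {d : nat} (g : Vec d -> R) (gx : Fin.t d -> Vec d -> R)
  (x : Vec d) (i : Fin.t d) (s : R) : partials g gx ->
  exists th, 0 <= th <= 1 /\ g (shift x i s) - g x = gx i (shift x i (th * s)) * s.
Proof.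
intros H.
destruct (mean_value (fun th => g (shift x i (th * s))) (fun th => s * gx i (shift x i (th * s))) 0 1)
  as [th [_ [Hth E]]].
- intros th _; apply (is_derive_comp (fun u => g (shift x i u)) (fun th => th * s)).
  + now apply is_derive_shift.
  + auto_derive; [easy|ring].
- exists th; rewrite Rmin_left, Rmax_right in Hth by lra; split; [assumption|].
  rewrite Rmult_0_l, shift_0, Rmult_1_l in E; lra.
Qed.

(** The parameter may depend on the coordinate: z lies in the box spanned by x and y, in general off
    the segment, because coordinates are changed one at a time. *)
Definition between {d : nat} (x y z : Vec d) : Prop :=
  forall j, exists th, 0 <= th <= 1 /\ z j = x j + th * (y j - x j).

(* Changing the coordinates of x into those of y one at a time needs only the
   partial derivatives, each at its own intermediate point. *)
Lemma mean_value_list {d : nat} (g : Vec d -> R) (gx : Fin.t d -> Vec d -> R)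
  (l : list (Fin.t d)) : partials g gx -> NoDup l ->
  forall x y : Vec d, (forall j, ~ In j l -> x j = y j) ->
  exists z : Fin.t d -> Vec d, (forall i, between x y (z i)) /\
    g y - g x = lsum l (fun i => gx i (z i) * (y i - x i)).
Proof.
intros H; induction 1 as [|i l Hi Hl IH]; intros x y Hxy.
- exists (fun _ => x); split.
  + intros _ j; exists 0; split; [lra|ring].
  + replace y with x by (apply functional_extensionality; auto). simpl; ring.
- set (w := shift x i (y i - x i)).
  assert (Wi : w i = y i) by (unfold w; rewrite shift_same; ring).
  assert (Wj : forall j, i <> j -> w j = x j) by (intros; now apply shift_other).
  destruct (IH w y) as [z [Hz Ez]].
  { intros j Hj; destruct (Fin.eq_dec i j) as [<-|N]; [assumption|].
    rewrite Wj by assumption; apply Hxy; intros [|]; auto. }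
  destruct (mean_value_shift g gx x i (y i - x i) H) as [th [Hth Et]]; fold w in Et.
  exists (fun k => if Fin.eqb k i then shift x i (th * (y i - x i)) else z k); split.
  + intros k j; destruct (Fin.eqb k i); destruct (Fin.eq_dec i j) as [<-|N].
    * exists th; rewrite shift_same; auto.
    * exists 0; rewrite shift_other by assumption; split; [lra|ring].
    * exists 1; split; [lra|]. destruct (Hz k i) as [th' [_ E]]; rewrite E, Wi; ring.
    * destruct (Hz k j) as [th' [Ht E]]; exists th'; rewrite E, Wj by assumption; auto.
  + simpl. rewrite (proj2 (Fin.eqb_eq d i i) eq_refl).
    rewrite (lsum_ext l _ (fun k => gx k (z k) * (y k - w k))).
    * rewrite <- Et, <- Ez; ring.
    * intros k Hk.
      assert (N : i <> k) by (intros ->; contradiction).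
      destruct (Fin.eqb k i) eqn:E; [apply Fin.eqb_eq in E; congruence|].
      now rewrite Wj.
Qed.

Lemma mean_value_vec {d : nat} (g : Vec d -> R) (gx : Fin.t d -> Vec d -> R) (x y : Vec d) :
  partials g gx ->
  exists z : Fin.t d -> Vec d, (forall i, between x y (z i)) /\
    g y - g x = vsum (fun i => gx i (z i) * (y i - x i)).
Proof.
intros H; apply mean_value_list; [assumption|apply NoDup_fins|].
intros j Hj; destruct Hj; apply In_fins.
Qed.

Lemma between_dist {d : nat} (x y z : Vec d) (j : Fin.t d) :
  between x y z -> Rabs (z j - x j) <= Rabs (y j - x j).
Proof.
intros H; destruct (H j) as [th [Ht ->]].
replace (x j + th * (y j - x j) - x j) with (th * (y j - x j)) by ring.
rewrite Rabs_mult, (Rabs_pos_eq th) by lra.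
generalize (Rabs_pos (y j - x j)); nra.
Qed.

Lemma between_box {d : nat} (a x y z : Vec d) (m : R) (j : Fin.t d) :
  between x y z -> Rabs (x j - a j) <= m -> Rabs (y j - a j) <= m -> Rabs (z j - a j) <= m.
Proof.
intros H Hx Hy; destruct (H j) as [th [Ht ->]].
replace (x j + th * (y j - x j) - a j)
  with ((1 - th) * (x j - a j) + th * (y j - a j)) by ring.
eapply Rle_trans; [apply Rabs_triang|].
rewrite !Rabs_mult, (Rabs_pos_eq th), (Rabs_pos_eq (1 - th)) by lra; nra.
Qed.

(** Coquelicot states compactness of boxes for nested tuples [Tn]; [tovec] and [fromvec] translate
    to functions on [Fin.t d]. *)
Fixpoint tovec (d : nat) : Compactness.Tn d R -> Vec d :=
  match d with
  | O => fun _ i => Fin.case0 (fun _ => R) i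
  | S n => fun p i => Fin.caseS' i (fun _ => R) (fst p) (fun k => tovec n (snd p) k)
  end.

Fixpoint fromvec (d : nat) : Vec d -> Compactness.Tn d R :=
  match d with
  | O => fun _ => tt
  | S n => fun x => (x Fin.F1, fromvec n (fun k => x (Fin.FS k)))
  end.

Lemma tovec_fromvec (d : nat) (x : Vec d) (i : Fin.t d) : tovec d (fromvec d x) i = x i.
Proof.
revert x; induction i as [d|d i IH]; intros x; simpl; [easy|].
apply (IH (fun k => x (Fin.FS k))).
Qed.

Lemma bounded_fromvec (d : nat) (a b x : Vec d) :
  (forall i, a i <= x i <= b i) -> bounded_n d (fromvec d a) (fromvec d b) (fromvec d x).
Proof.
induction d as [|d IH]; intros H; simpl; [easy|].
split; [apply H|apply IH; intros; apply H].
Qed.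

Lemma close_tovec (d : nat) (e : R) (x y : Compactness.Tn d R) :
  close_n d e x y -> forall i, Rabs (tovec d x i - tovec d y i) < e.
Proof.
intros H i; revert x y H; induction i as [d|d i IH]; intros [x1 x2] [y1 y2] [H1 H2]; simpl.
- exact H1.
- now apply IH.
Qed.

(** Compactness of the box in R^(1+d), with time as the first coordinate: finitely many
    neighbourhoods on which g varies by less than 1 cover it, so the sum of the values at their
    centres plus 1 is a bound. *)
Lemma C0_bounded {d : nat} (g : R -> Vec d -> R) (t0 a : R) (q0 : Vec d) (m : R) : C0 g ->
  exists K, 0 <= K /\ forall t x, Rabs (t - t0) <= a -> (forall i, Rabs (x i - q0 i) <= m) ->
    Rabs (g t x) <= K.
Proof.
intros Hg.
assert (D : forall p : Compactness.Tn (S d) R, exists de : posreal,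
  forall t x, Rabs (t - fst p) < de -> (forall i, Rabs (x i - tovec d (snd p) i) < de) ->
    Rabs (g t x - g (fst p) (tovec d (snd p))) < 1).
{ intros p; destruct (Hg (fst p) (tovec d (snd p)) 1 Rlt_0_1) as [de [Hde H]].
  exists (mkposreal de Hde); exact H. }
destruct (functional_choice _ D) as [de Hde]; clear D.
(* The finite subcover is available only under a double negation. *)
apply NNPP; intros N.
apply (compactness_list (S d) (fromvec (S d) (fun i => Fin.caseS' i (fun _ => R) (t0 - a) (fun k => q0 k - m)))
   (fromvec (S d) (fun i => Fin.caseS' i (fun _ => R) (t0 + a) (fun k => q0 k + m))) de).
intros [l Hl]; apply N; clear N.
exists (lsum l (fun p => Rabs (g (fst p) (tovec d (snd p)))) + 1); split.
{ generalize (lsum_pos l (fun p => Rabs (g (fst p) (tovec d (snd p)))) (fun _ => Rabs_pos _)); lra. }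
intros t x Ht Hx.
destruct (Hl (t, fromvec d x)) as [p [Hp [_ Hc]]].
{ apply (bounded_fromvec (S d) _ _ (fun i => Fin.caseS' i (fun _ => R) t x)).
  intros i; pattern i; apply (Fin.caseS' i); simpl.
  - apply Rabs_le_between in Ht; split; lra.
  - intros k; specialize (Hx k); apply Rabs_le_between in Hx; split; lra. }
destruct p as [p1 p2]; destruct Hc as [C1 C2].
assert (B := Hde (p1, p2) t x C1); simpl in B.
assert (B' : Rabs (g t x - g p1 (tovec d p2)) < 1).
{ apply B; intros i; rewrite <- (tovec_fromvec d x i); now apply close_tovec. }
assert (L : Rabs (g p1 (tovec d p2)) <= lsum l (fun p => Rabs (g (fst p) (tovec d (snd p)))))
  by exact (lsum_term_le l (fun p => Rabs (g (fst p) (tovec d (snd p)))) (p1, p2)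
              (fun _ => Rabs_pos _) Hp).
assert (T := Rabs_triang_inv (g t x) (g p1 (tovec d p2))); lra.
Qed.

Lemma Rabs_lt_locally (y : R -> R) (t eps : R) : continuous y t -> 0 < eps ->
  locally t (fun s => Rabs (y s - y t) < eps).
Proof.
intros H He; apply (H (fun w => Rabs (w - y t) < eps)).
exists (mkposreal eps He); intros w Hw; exact Hw.
Qed.

Lemma locally_list {T : Type} (l : list T) (t : R) (P : T -> R -> Prop) :
  (forall i, locally t (P i)) -> locally t (fun s => forall i, In i l -> P i s).
Proof.
intros H; induction l as [|a l IH].
- apply filter_forall; intros s i [].
- generalize (filter_and _ _ (H a) IH); apply filter_imp.
  intros s [Ha Hl] i [<-|Hi]; auto.
Qed.

(** * The chain rule along a curve *)

Lemma C0_comp {d : nat} (g : R -> Vec d -> R) (c : R -> R) (z : R -> Vec d) (t : R) :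
  C0 g -> continuous c t -> (forall i, continuous (fun s => z s i) t) ->
  continuous (fun s => g (c s) (z s)) t.
Proof.
intros Hg Hc Hz P [eps HP].
destruct (Hg (c t) (z t) eps (cond_pos eps)) as [de [Hde H]].
change (locally t (fun s => P (g (c s) (z s)))).
generalize (filter_and _ _ (Rabs_lt_locally c t de Hc Hde)
  (locally_list (fins d) t (fun i s => Rabs (z s i - z t i) < de)
     (fun i => Rabs_lt_locally (fun s => z s i) t de (Hz i) Hde))).
apply filter_imp; intros s [H1 H2]; apply HP, H; [exact H1|intros i; apply H2, In_fins].
Qed.

(** For intermediate points picked by a mean value theorem: they are chosen without any regularity,
    but are squeezed at t. *)
Lemma continuous_dominated (c y : R -> R) (t : R) : continuous y t ->
  (forall s, Rabs (c s - c t) <= Rabs (y s - y t)) -> continuous c t.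
Proof.
intros Hy H P [eps HP].
change (locally t (fun s => P (c s))).
generalize (Rabs_lt_locally y t eps Hy (cond_pos eps)); apply filter_imp.
intros s Hs; apply HP; eapply Rle_lt_trans; [apply H|exact Hs].
Qed.

(** Carathéodory's form of differentiability: a slope function continuous at t. It spares the chain
    rule all quotients and the case s = t. *)
Lemma caratheodory (y psi : R -> R) (t : R) :
  (forall s, y s - y t = psi s * (s - t)) -> continuous psi t -> is_derive y t (psi t).
Proof.
intros E Hc; apply is_derive_Reals; intros eps He.
destruct (Rabs_lt_locally psi t eps Hc He) as [de Hde]; exists de.
intros h Hh Hd. replace (y (t + h) - y t) with (psi (t + h) * h) by (rewrite E; ring).
replace (psi (t + h) * h / h) with (psi (t + h)) by (field; assumption).
apply Hde. change (Rabs (t + h - t) < de). now replace (t + h - t) with h by ring.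
Qed.

Lemma caratheodory_slope (y : R -> R) (t l : R) : is_derive y t l ->
  exists psi, (forall s, y s - y t = psi s * (s - t)) /\ continuous psi t /\ psi t = l.
Proof.
intros H; apply is_derive_Reals in H.
exists (fun s => if Req_EM_T s t then l else (y s - y t) / (s - t)); split; [|split].
- intros s; destruct (Req_EM_T s t) as [->|N]; [ring|field; lra].
- intros P [eps HP]; destruct (H eps (cond_pos eps)) as [de Hde].
  exists de; intros s Hs; apply HP.
  destruct (Req_EM_T t t) as [_|]; [|easy].
  destruct (Req_EM_T s t) as [->|N]; [apply ball_center|].
  change (Rabs ((y s - y t) / (s - t) - l) < eps).
  replace s with (t + (s - t)) at 1 by ring. apply Hde; [lra|exact Hs].
- now destruct (Req_EM_T t t).
Qed.

Lemma continuous_lsum {T : Type} (l : list T) (f : T -> R -> R) (t : R) :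
  (forall i, continuous (f i) t) -> continuous (fun s => lsum l (fun i => f i s)) t.
Proof.
intros H; induction l as [|a l IH]; simpl; [apply continuous_const|].
exact (continuous_plus _ _ t (H a) IH).
Qed.

(** The increment is split into a time part at fixed q(s) and coordinate parts at fixed t, each
    given by a mean value formula. The resulting slope function is continuous at t because the
    partial derivatives are and the intermediate points converge. *)
Lemma chain_rule {d : nat} (g gt : R -> Vec d -> R) (gx : Fin.t d -> R -> Vec d -> R)
  (q : R -> Vec d) (v : Vec d) (t : R) :
  (forall t x, derivable_pt_lim (fun s => g s x) t (gt t x)) -> C0 gt ->
  (forall i t x, derivable_pt_lim (fun s => g t (shift x i s)) 0 (gx i t x)) ->
  (forall i, C0 (gx i)) ->
  (forall i, is_derive (fun s => q s i) t (v i)) ->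
  is_derive (fun s => g s (q s)) t (gt t (q t) + vsum (fun i => gx i t (q t) * v i)).
Proof.
intros Ht Ct Hx Cx Hq.
assert (Cq : forall i, continuous (fun s => q s i) t)
  by (intros; apply @ex_derive_continuous; eexists; apply Hq).
assert (Ec : forall s, exists c, Rabs (c - t) <= Rabs (s - t) /\
   g s (q s) - g t (q s) = gt c (q s) * (s - t)).
{ intros s; destruct (mean_value (fun u => g u (q s)) (fun u => gt u (q s)) t s) as [c [H1 [_ H2]]].
  - intros; apply is_derive_Reals, Ht.
  - exists c; auto. }
assert (Ez : forall s, exists z : Fin.t d -> Vec d, (forall i, between (q t) (q s) (z i)) /\
   g t (q s) - g t (q t) = vsum (fun i => gx i t (z i) * (q s i - q t i))).
{ intros s; apply (mean_value_vec (g t) (fun i => gx i t)); intros i x; apply Hx. }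
destruct (functional_choice _ Ec) as [c Hc], (functional_choice _ Ez) as [z Hz].
assert (Ek : forall i, exists k, (forall s, q s i - q t i = k s * (s - t)) /\
  continuous k t /\ k t = v i)
  by (intros i; apply (caratheodory_slope (fun s => q s i)), Hq).
destruct (functional_choice _ Ek) as [k Hk].
assert (ct : c t = t).
{ destruct (Hc t) as [H _]. replace (t - t) with 0 in H by ring. rewrite Rabs_R0 in H.
  revert H; unfold Rabs; destruct Rcase_abs; lra. }
assert (zt : forall i j, z t i j = q t j).
{ intros i j; destruct (Hz t) as [H _]; destruct (H i j) as [th [_ E]]; rewrite E; ring. }
assert (zq : forall i, z t i = q t) by (intros; apply functional_extensionality, zt).
replace (gt t (q t) + vsum (fun i => gx i t (q t) * v i))
  with (gt (c t) (q t) + vsum (fun i => gx i t (z t i) * k i t)).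
- apply (caratheodory _ (fun s => gt (c s) (q s) + vsum (fun i => gx i t (z s i) * k i s))).
  + intros s. replace (g s (q s) - g t (q t))
      with ((g s (q s) - g t (q s)) + (g t (q s) - g t (q t))) by ring.
    rewrite (proj2 (Hc s)), (proj2 (Hz s)).
    rewrite Rmult_plus_distr_r, (Rmult_comm (vsum _)); unfold vsum.
    rewrite <- lsum_scal; f_equal; apply lsum_ext; intros i _.
    rewrite (proj1 (Hk i) s); ring.
  + apply @continuous_plus.
    * apply C0_comp; [assumption| |assumption].
      apply (continuous_dominated c (fun s => s)); [apply continuous_id|].
      intros s; rewrite ct; apply Hc.
    * apply (continuous_lsum (fins d) (fun i s => gx i t (z s i) * k i s)); intros i.
      apply @continuous_mult; [|apply Hk].
      apply (C0_comp (gx i) (fun _ => t) (fun s => z s i)); [apply Cx|apply continuous_const|].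
      intros j; apply (continuous_dominated _ (fun s => q s j)); [apply Cq|].
      intros s; rewrite zt; apply between_dist, Hz.
- rewrite ct; f_equal; apply lsum_ext; intros i _; now rewrite zq, (proj2 (proj2 (Hk i))).
Qed.

(** * Regularity of functions along the exact solution *)

Fixpoint Cn (n : nat) (a b : R) (y : R -> R) : Prop :=
  match n with
  | O => forall t, a < t < b -> continuous y t
  | S n' => exists y', (forall t, a < t < b -> is_derive y t (y' t)) /\ Cn n' a b y'
  end.

Lemma Cn_weaken (n : nat) (a b : R) (y : R -> R) : Cn (S n) a b y -> Cn n a b y.
Proof.
revert y; induction n as [|n IH]; intros y [y' [H H']].
- intros t Ht; apply @ex_derive_continuous; eexists; now apply H.
- exists y'; split; [assumption|now apply IH].
Qed.

Lemma Cn_plus (n : nat) (a b : R) (y z : R -> R) :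
  Cn n a b y -> Cn n a b z -> Cn n a b (fun t => y t + z t).
Proof.
revert y z; induction n as [|n IH]; intros y z.
- intros Hy Hz t Ht; exact (continuous_plus _ _ t (Hy t Ht) (Hz t Ht)).
- intros [y' [Hy Hy']] [z' [Hz Hz']]; exists (fun t => y' t + z' t); split; [|now apply IH].
  intros t Ht; exact (is_derive_plus _ _ t _ _ (Hy t Ht) (Hz t Ht)).
Qed.

Lemma Cn_mult (n : nat) (a b : R) (y z : R -> R) :
  Cn n a b y -> Cn n a b z -> Cn n a b (fun t => y t * z t).
Proof.
revert y z; induction n as [|n IH]; intros y z Cy Cz.
- intros t Ht; exact (continuous_mult _ _ t (Cy t Ht) (Cz t Ht)).
- assert (Cy0 := Cn_weaken _ _ _ _ Cy); assert (Cz0 := Cn_weaken _ _ _ _ Cz).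
  destruct Cy as [y' [Hy Hy']], Cz as [z' [Hz Hz']].
  exists (fun t => y' t * z t + y t * z' t); split; [|apply Cn_plus; now apply IH].
  intros t Ht; exact (is_derive_mult _ _ t _ _ (Hy t Ht) (Hz t Ht) Rmult_comm).
Qed.

Lemma Cn_const (n : nat) (a b c : R) : Cn n a b (fun _ => c).
Proof.
revert c; induction n as [|n IH]; intros c.
- intros t _; apply continuous_const.
- exists (fun _ => 0); split; [|apply IH]. intros t _; apply @is_derive_const.
Qed.

Lemma Cn_lsum {T : Type} (l : list T) (n : nat) (a b : R) (y : T -> R -> R) :
  (forall i, Cn n a b (y i)) -> Cn n a b (fun t => lsum l (fun i => y i t)).
Proof.
intros H; induction l as [|i l IH]; simpl; [apply Cn_const|now apply Cn_plus].
Qed.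

Lemma Ck_C0 {d : nat} (k : nat) (g : R -> Vec d -> R) : Ck k g -> C0 g.
Proof. destruct k; simpl; [easy|now intros []]. Qed.

Section Trajectory.
Variables (d : nat) (f : R -> Vec d -> Vec d) (a b : R) (q v : R -> Vec d).
Hypothesis smooth_f : smooth f.
Hypothesis q_deriv : forall t, a < t < b -> forall i, is_derive (fun s => q s i) t (v t i).
Hypothesis v_deriv : forall t, a < t < b -> forall i, is_derive (fun s => v s i) t (f t (q t) i).

Lemma continuous_trajectory (i : Fin.t d) (t : R) : a < t < b -> continuous (fun s => q s i) t.
Proof. intros; apply @ex_derive_continuous; eexists; now apply q_deriv. Qed.

(** The induction runs over all g at once: the derivative of g(t,q) involves the partials of g and
    also v, whose own derivative f(t,q) is again of the form covered by the induction hypothesis. *)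
Lemma Cn_trajectory (n : nat) : forall g : R -> Vec d -> R, Ck n g -> Cn n a b (fun t => g t (q t)).
Proof.
induction n as [|n IH]; intros g Hg.
- intros t Ht; apply C0_comp; [assumption|apply continuous_id|].
  intros; now apply continuous_trajectory.
- destruct Hg as [_ [[gt [Ht Ct]] [gx [Hx Cx]]]].
  exists (fun t => gt t (q t) + vsum (fun i => gx i t (q t) * v t i)); split.
  + intros t Hin; apply (chain_rule g); auto.
    * now apply (Ck_C0 n).
    * intros; now apply (Ck_C0 n).
  + apply Cn_plus; [now apply IH|].
    apply (Cn_lsum (fins d) n a b (fun i t => gx i t (q t) * v t i)); intros i.
    apply Cn_mult; [now apply IH|].
    apply Cn_weaken; exists (fun t => f t (q t) i); split; [intros; now apply v_deriv|].
    apply (IH (fun t x => f t x i)), smooth_f.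
Qed.
End Trajectory.

(** * Taylor expansions with bounded remainder *)

Lemma fsum_head (n : nat) (f : nat -> R) : fsum (S n) f = f 0%nat + fsum n (fun k => f (S k)).
Proof.
induction n as [|n IH]; [simpl; ring|].
change (fsum (S n) f + f (S n) = f 0%nat + (fsum n (fun k => f (S k)) + f (S n))).
rewrite IH; ring.
Qed.

Lemma is_derive_monomial (c u : R) (m : nat) :
  is_derive (fun w => c * w ^ S m / (INR m + 1)) u (c * u ^ m).
Proof.
assert (0 < INR m + 1) by (generalize (pos_INR m); lra).
replace (c * u ^ m) with (c / (INR m + 1) * (INR (S m) * 1 * u ^ pred (S m)))
  by (rewrite S_INR; cbn [pred]; field; lra).
apply (is_derive_ext (fun w => c / (INR m + 1) * w ^ S m)).
- intros w; change (c / (INR m + 1) * w ^ S m = c * w ^ S m / (INR m + 1)); field; lra.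
- apply is_derive_scal, (is_derive_pow (fun y => y)), @is_derive_id.
Qed.

Lemma is_derive_fsum (n : nat) (f f' : nat -> R -> R) (u : R) :
  (forall k, is_derive (f k) u (f' k u)) ->
  is_derive (fun w => fsum n (fun k => f k w)) u (fsum n (fun k => f' k u)).
Proof.
intros H; induction n as [|n IH]; simpl; [apply @is_derive_const|].
exact (is_derive_plus _ _ u _ _ IH (H n)).
Qed.

(** By the mean value theorem for the remainder, integrating an expansion raises the error exponent
    by one and keeps K. The offset [p] in the exponents allows two integrations in a row, from f to
    v to q. *)
Lemma expansion_primitive (y z : R -> R) (t0 r K : R) (n p m : nat) (c : nat -> R) :
  0 <= K ->
  (forall u, Rabs u <= r -> is_derive y (t0 + u) (z (t0 + u))) ->
  (forall u, Rabs u <= r ->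
     Rabs (z (t0 + u) - fsum n (fun k => c k * u ^ (k + p))) <= K * Rabs u ^ m) ->
  forall u, Rabs u <= r ->
     Rabs (y (t0 + u) - y t0 - fsum n (fun k => c k * u ^ S (k + p) / (INR (k + p) + 1)))
     <= K * Rabs u ^ S m.
Proof.
intros HK Hy Hz u Hu.
set (w := fun u => y (t0 + u) - fsum n (fun k => c k * u ^ S (k + p) / (INR (k + p) + 1))).
destruct (mean_value w (fun u => z (t0 + u) - fsum n (fun k => c k * u ^ (k + p))) 0 u)
  as [x [Hx [_ E]]].
- intros s Hs.
  assert (Hsr : Rabs s <= r).
  { eapply Rle_trans; [|exact Hu].
    revert Hs; unfold Rmin, Rmax, Rabs; repeat destruct Rle_dec; repeat destruct Rcase_abs; lra. }
  apply (is_derive_minus (V := R_NormedModule) (fun u => y (t0 + u))).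
  + replace (z (t0 + s)) with (1 * z (t0 + s)) by apply Rmult_1_l.
    apply (is_derive_comp y (fun u => t0 + u)); [now apply Hy|auto_derive; [easy|ring]].
  + apply (is_derive_fsum n (fun k u => c k * u ^ S (k + p) / (INR (k + p) + 1))
             (fun k u => c k * u ^ (k + p))).
    intros; apply is_derive_monomial.
- rewrite !Rminus_0_r in *.
  assert (W0 : w 0 = y t0).
  { unfold w; rewrite Rplus_0_r, fsum_zero; [ring|].
    intros k _; rewrite pow_i by lia; unfold Rdiv; ring. }
  replace (y (t0 + u) - y t0 - _) with (w u - w 0) by (rewrite W0; unfold w; ring).
  rewrite E, Rabs_mult; simpl.
  assert (Hz' := Hz x ltac:(lra)).
  assert (P : Rabs x ^ m <= Rabs u ^ m) by (apply pow_incr; split; [apply Rabs_pos|assumption]).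
  rewrite (Rmult_comm (Rabs u)), <- Rmult_assoc.
  apply Rmult_le_compat_r; [apply Rabs_pos|].
  eapply Rle_trans; [exact Hz'|now apply Rmult_le_compat_l].
Qed.

Lemma continuous_bounded (y : R -> R) (t0 r : R) :
  (forall t, Rabs (t - t0) <= r -> continuous y t) ->
  exists K, 0 <= K /\ forall t, Rabs (t - t0) <= r -> Rabs (y t) <= K.
Proof.
intros Hy.
destruct (Rlt_le_dec r 0) as [Hr|Hr].
{ exists 0; split; [lra|]; intros t Ht; generalize (Rabs_pos (t - t0)); lra. }
destruct (continuity_ab_maj (fun t => Rabs (y t)) (t0 - r) (t0 + r)) as [x [Hx _]]; [lra| |].
{ intros t Ht; apply continuity_pt_filterlim, (continuous_comp y Rabs).
  - apply Hy, Rabs_le_between; lra.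
  - apply continuous_Rabs. }
exists (Rabs (y x)); split; [apply Rabs_pos|].
intros t Ht; apply Hx; apply Rabs_le_between in Ht; split; lra.
Qed.

(** The expansion of y is the integrated expansion of y', so the coefficients need no formula. The
    margin r1 < r provides a compact interval on which the last derivative is bounded. *)
Lemma taylor_bound (n : nat) (t0 r r1 : R) (y : R -> R) : r1 < r ->
  Cn n (t0 - r) (t0 + r) y ->
  exists (c : nat -> R) (K : R), 0 <= K /\ forall u, Rabs u <= r1 ->
    Rabs (y (t0 + u) - fsum n (fun k => c k * u ^ k)) <= K * Rabs u ^ n.
Proof.
intros Hr; revert y; induction n as [|n IH]; intros y Hy.
- destruct (continuous_bounded y t0 r1) as [K [HK B]].
  { intros t Ht; apply Hy; apply Rabs_le_between in Ht; lra. }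
  exists (fun _ => 0), K; split; [assumption|]; intros u Hu; simpl.
  rewrite Rminus_0_r, Rmult_1_r; apply B. now replace (t0 + u - t0) with u by ring.
- destruct Hy as [y' [Hy Hy']]; destruct (IH y' Hy') as [c [K [HK B]]].
  exists (fun k => match k with O => y t0 | S k' => c k' / (INR k' + 1) end), K.
  split; [assumption|]; intros u Hu.
  rewrite fsum_head.
  rewrite (fsum_ext n _ (fun k => c k * u ^ S (k + 0) / (INR (k + 0) + 1))).
  + rewrite pow_O, (Rmult_1_r (y t0)).
    replace (y (t0 + u) - (y t0 + _)) with
      (y (t0 + u) - y t0 - fsum n (fun k => c k * u ^ S (k + 0) / (INR (k + 0) + 1))) by ring.
    apply (expansion_primitive y y' t0 r1 K n 0 n c); try assumption.
    * intros w Hw; apply Hy; apply Rabs_le_between in Hw; lra.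
    * intros w Hw; rewrite (fsum_ext n _ (fun k => c k * w ^ k)); [now apply B|].
      intros; now rewrite Nat.add_0_r.
  + intros k _; rewrite Nat.add_0_r; unfold Rdiv; ring.
Qed.

(** * Uniform O-estimates *)

Section BigO.
Variables (Om : Type) (hh : Om -> R).
Hypothesis hh_le : forall w, Rabs (hh w) <= 1.

(** One constant serves all indices w and all s in [0,1]; the step size is a function of the
    index. *)
Definition BigO (n : nat) (u : Om -> R -> R) : Prop :=
  exists K, 0 <= K /\ forall w s, 0 <= s <= 1 -> Rabs (u w s) <= K * Rabs (hh w) ^ n.

Lemma BigO_dom (n : nat) (u z : Om -> R -> R) :
  (forall w s, 0 <= s <= 1 -> Rabs (u w s) <= Rabs (z w s)) -> BigO n z -> BigO n u.
Proof.
intros H [K [HK B]]; exists K; split; [assumption|]; intros w s Hs.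
eapply Rle_trans; [now apply H|now apply B].
Qed.

Lemma BigO_ext (n : nat) (u z : Om -> R -> R) :
  (forall w s, 0 <= s <= 1 -> u w s = z w s) -> BigO n u -> BigO n z.
Proof. intros H; apply BigO_dom; intros; rewrite H by assumption; apply Rle_refl. Qed.

Lemma BigO_weaken (m n : nat) (u : Om -> R -> R) : (m <= n)%nat -> BigO n u -> BigO m u.
Proof.
intros Hmn [K [HK B]]; exists K; split; [assumption|]; intros w s Hs.
eapply Rle_trans; [now apply B|]; apply Rmult_le_compat_l; [assumption|].
replace n with (m + (n - m))%nat by lia; rewrite pow_add.
rewrite <- (Rmult_1_r (_ ^ m)) at 2.
apply Rmult_le_compat_l; [apply pow_le, Rabs_pos|].
rewrite <- (pow1 (n - m)); apply pow_incr; split; [apply Rabs_pos|apply hh_le].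
Qed.

Lemma BigO_plus (n : nat) (u z : Om -> R -> R) :
  BigO n u -> BigO n z -> BigO n (fun w s => u w s + z w s).
Proof.
intros [K [HK B]] [L [HL C]]; exists (K + L); split; [lra|]; intros w s Hs.
eapply Rle_trans; [apply Rabs_triang|]; rewrite Rmult_plus_distr_r.
now apply Rplus_le_compat; [apply B|apply C].
Qed.

Lemma BigO_mult (m n : nat) (u z : Om -> R -> R) :
  BigO m u -> BigO n z -> BigO (m + n) (fun w s => u w s * z w s).
Proof.
intros [K [HK B]] [L [HL C]]; exists (K * L); split; [now apply Rmult_le_pos|]; intros w s Hs.
rewrite Rabs_mult, pow_add.
replace (K * L * (Rabs (hh w) ^ m * Rabs (hh w) ^ n))
  with (K * Rabs (hh w) ^ m * (L * Rabs (hh w) ^ n)) by ring.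
apply Rmult_le_compat; auto using Rabs_pos.
Qed.

Lemma BigO_mult0 (n : nat) (u z : Om -> R -> R) :
  BigO 0 u -> BigO n z -> BigO n (fun w s => u w s * z w s).
Proof. exact (BigO_mult 0 n u z). Qed.

Lemma BigO_opp (n : nat) (u : Om -> R -> R) : BigO n u -> BigO n (fun w s => - u w s).
Proof. apply BigO_dom; intros; rewrite Rabs_Ropp; apply Rle_refl. Qed.

Lemma BigO_minus (n : nat) (u z : Om -> R -> R) :
  BigO n u -> BigO n z -> BigO n (fun w s => u w s - z w s).
Proof. intros Hu Hz; exact (BigO_plus n u _ Hu (BigO_opp n z Hz)). Qed.

Lemma BigO_zero (n : nat) : BigO n (fun _ _ => 0).
Proof. exists 0; split; [lra|]; intros; rewrite Rabs_R0; lra. Qed.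

Lemma BigO_lsum {T : Type} (l : list T) (n : nat) (u : T -> Om -> R -> R) :
  (forall i, BigO n (u i)) -> BigO n (fun w s => lsum l (fun i => u i w s)).
Proof.
intros H; induction l as [|i l IH]; simpl; [apply BigO_zero|].
apply (BigO_plus n (u i)); auto.
Qed.

Lemma BigO_fun (g : R -> R) : cont01 g -> BigO 0 (fun _ s => g s).
Proof.
intros H; destruct (cont01_bounded g H) as [K B]; exists K; split.
- eapply Rle_trans; [apply Rabs_pos|apply (B 0); lra].
- intros w s Hs; simpl; rewrite Rmult_1_r; auto.
Qed.

Lemma BigO_const (c : R) : BigO 0 (fun _ _ => c).
Proof. apply (BigO_fun (fun _ => c)), cont01_const. Qed.

Lemma BigO_h (n : nat) : BigO n (fun w _ => hh w ^ n).
Proof. exists 1; split; [lra|]; intros; rewrite RPow_abs; lra. Qed.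

Lemma BigO_h_mult (n p : nat) (u : Om -> R -> R) :
  BigO n u -> BigO (p + n) (fun w s => hh w ^ p * u w s).
Proof. apply BigO_mult, BigO_h. Qed.

Lemma BigO_step (n : nat) : BigO 0 (fun w _ => hh w ^ n).
Proof. apply (BigO_weaken 0 n); [lia|apply BigO_h]. Qed.

Lemma BigO_h_bounded (n : nat) (u : Om -> R -> R) :
  BigO 0 u -> BigO n (fun w s => hh w ^ n * u w s).
Proof. intros H; rewrite <- (Nat.add_0_r n) at 1; now apply BigO_h_mult. Qed.

Lemma BigO_Aop (Abar : R -> R -> R) (n : nat) (u : Om -> R -> R) : bounded2 Abar ->
  (forall w tau, 0 <= tau <= 1 -> ex01 (fun s => Abar tau s * u w s)) ->
  BigO n u -> BigO n (fun w => Aop Abar (u w)).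
Proof.
intros [m Hm] Hx [K [HK B]]; exists (m * K).
assert (Hm0 : 0 <= m) by (eapply Rle_trans; [apply Rabs_pos|apply (Hm 0 0); lra]).
split; [now apply Rmult_le_pos|]; intros w tau Ht; unfold Aop.
apply I01_abs_le; [now apply Hx|]; intros s Hs.
rewrite Rabs_mult, Rmult_assoc; apply Rmult_le_compat; auto using Rabs_pos.
Qed.

(** Integrability is included because [I01] has a value even where no integral exists, while
    linearity requires one. *)
Definition null01 (g : R -> R) : Prop := ex01 g /\ I01 g = 0.

Lemma null01_plus (f g : R -> R) : null01 f -> null01 g -> null01 (fun x => f x + g x).
Proof.
intros [Hf If] [Hg Ig]; split; [now apply ex01_plus|rewrite I01_plus, If, Ig by assumption; ring].
Qed.

Lemma null01_scal (c : R) (f : R -> R) : null01 f -> null01 (fun x => c * f x).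
Proof. intros [Hf If]; split; [now apply ex01_scal|rewrite I01_scal, If by assumption; ring]. Qed.

Lemma null01_ext (f g : R -> R) : (forall x, f x = g x) -> null01 f -> null01 g.
Proof.
intros E [Hf If]; split; [apply (ex01_ext f); auto|rewrite <- If; apply I01_ext; auto].
Qed.

Lemma null01_lsum {T : Type} (l : list T) (f : T -> R -> R) :
  (forall i, null01 (f i)) -> null01 (fun x => lsum l (fun i => f i x)).
Proof.
intros H; induction l as [|i l IH]; simpl; [split; [apply ex01_const|apply I01_const]|].
now apply null01_plus.
Qed.

(** A main part whose weighted integral vanishes is subtracted for free, so the order is that of the
    remainder, whatever the size of u. *)
Lemma I01_BigO (n : nat) (g : R -> R) (u main : Om -> R -> R) :
  cont01 g -> (forall w, ex01 (fun s => g s * u w s)) ->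
  (forall w, null01 (fun s => g s * main w s)) ->
  BigO n (fun w s => u w s - main w s) ->
  exists K, 0 <= K /\ forall w, Rabs (I01 (fun s => g s * u w s)) <= K * Rabs (hh w) ^ n.
Proof.
intros Hg Hu Hm HB.
destruct (BigO_mult0 n _ _ (BigO_fun g Hg) HB) as [K [HK B]].
exists K; split; [assumption|]; intros w; destruct (Hm w) as [Xm Im].
replace (I01 (fun s => g s * u w s)) with (I01 (fun s => g s * u w s - g s * main w s))
  by (rewrite I01_minus, Im by auto; ring).
apply I01_abs_le; [now apply ex01_minus|].
intros s Hs; rewrite <- Rmult_minus_distr_l; now apply B.
Qed.

End BigO.

Lemma lipschitz_box {d : nat} (g : R -> Vec d -> R) (t0 a m : R) (q0 : Vec d) : Ck 1 g ->
  exists L, 0 <= L /\ forall t x y, Rabs (t - t0) <= a ->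
    (forall i, Rabs (x i - q0 i) <= m) -> (forall i, Rabs (y i - q0 i) <= m) ->
    Rabs (g t y - g t x) <= L * vsum (fun i => Rabs (y i - x i)).
Proof.
intros [_ [_ [gx [Hx Cx]]]].
destruct (functional_choice _ (fun i => C0_bounded (gx i) t0 a q0 m (Cx i))) as [K HK].
exists (vsum K); split; [apply lsum_pos; intros; apply HK|].
intros t x y Ht Bx By.
destruct (mean_value_vec (g t) (fun i => gx i t) x y) as [z [Hz ->]]; [intros i w; apply Hx|].
eapply Rle_trans; [apply lsum_abs|]; unfold vsum at 2; rewrite <- lsum_scal.
apply lsum_le; intros i _; rewrite Rabs_mult.
apply Rmult_le_compat_r; [apply Rabs_pos|].
eapply Rle_trans; [|apply (vsum_term_le K i); intros; apply HK].
apply HK; [assumption|intros j; now apply (between_box q0 x y)].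
Qed.

(** A substitute for the second-order Taylor formula: the mean value formula for g, then Lipschitz
    bounds that move each partial derivative from its intermediate point back to x. *)
Lemma quadratic_box {d : nat} (g : R -> Vec d -> R) (gx : Fin.t d -> R -> Vec d -> R)
  (t0 a m : R) (q0 : Vec d) :
  (forall i t x, derivable_pt_lim (fun s => g t (shift x i s)) 0 (gx i t x)) ->
  (forall i, Ck 1 (gx i)) ->
  exists L, 0 <= L /\ forall t x y, Rabs (t - t0) <= a ->
    (forall i, Rabs (x i - q0 i) <= m) -> (forall i, Rabs (y i - q0 i) <= m) ->
    Rabs (g t y - g t x - vsum (fun i => gx i t x * (y i - x i)))
    <= L * (vsum (fun i => Rabs (y i - x i)) * vsum (fun i => Rabs (y i - x i))).
Proof.
intros Hx Cx.
destruct (functional_choice _ (fun i => lipschitz_box (gx i) t0 a m q0 (Cx i))) as [K HK].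
exists (vsum K); split; [apply lsum_pos; intros; apply HK|].
intros t x y Ht Bx By.
destruct (mean_value_vec (g t) (fun i => gx i t) x y) as [z [Hz ->]]; [intros i w; apply Hx|].
set (N := vsum (fun i => Rabs (y i - x i))).
replace (vsum (fun i => gx i t (z i) * (y i - x i)) - vsum (fun i => gx i t x * (y i - x i)))
  with (vsum (fun i => (gx i t (z i) - gx i t x) * (y i - x i))).
2:{ unfold vsum; rewrite (lsum_ext _ _ (fun i => gx i t (z i) * (y i - x i)
      + -1 * (gx i t x * (y i - x i)))), lsum_plus, lsum_scal by (intros; ring); ring. }
eapply Rle_trans; [apply lsum_abs|].
replace (vsum K * (N * N)) with (lsum (fins d) (fun i => vsum K * N * Rabs (y i - x i)))
  by (rewrite lsum_scal; fold (vsum (fun i => Rabs (y i - x i))); fold N; ring).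
apply lsum_le; intros i _; rewrite Rabs_mult.
apply Rmult_le_compat_r; [apply Rabs_pos|].
eapply Rle_trans; [apply (HK i); [assumption|assumption|]|].
- intros j; now apply (between_box q0 x y).
- apply Rmult_le_compat.
  + apply HK.
  + apply lsum_pos; intros; apply Rabs_pos.
  + apply vsum_term_le; intros; apply HK.
  + apply lsum_le; intros j _; now apply between_dist.
Qed.

(** * Expansion of the stage error *)

Lemma lsum_minus {T : Type} (l : list T) (f g : T -> R) :
  lsum l (fun i => f i - g i) = lsum l f - lsum l g.
Proof. induction l as [|a l IH]; simpl; [ring|rewrite IH; ring]. Qed.

Ltac bigO0 :=
  lazymatch goal with
  | |- BigO _ _ 0 (fun w s => @?a w s + @?b w s) =>
      apply (BigO_plus _ _ 0 a b); bigO0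
  | |- BigO _ _ 0 (fun w s => @?a w s * @?b w s) =>
      apply (BigO_mult0 _ _ 0 a b); bigO0
  | |- BigO _ _ 0 (fun w _ => _ ^ _) =>
      first [ apply BigO_step; assumption | apply BigO_fun, cont01_pow ]
  | |- _ => first [ apply BigO_const | assumption | apply BigO_fun; eauto ]
  end.

(** The Taylor polynomial of the Jacobian in the elapsed time s h. Degree two is enough: its
    remainder times E is O(h^(3+p)) when E = O(h^p), no worse than the quadratic error O(h^(2p)) as
    long as p <= 3. *)
Definition jacobian_poly {Om : Type} (hh : Om -> R) {d : nat}
  (J : Fin.t d -> Fin.t d -> nat -> R) (i j : Fin.t d) (w : Om) (s : R) : R :=
  J i j 0%nat + J i j 1%nat * (s * hh w) + J i j 2%nat * (s * hh w) ^ 2.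

Section Expansion.
Variables (alpha : nat -> nat -> R) (Abar : R -> R -> R).
Hypothesis kernel : legendre_kernel alpha Abar.
Variables (Om : Type) (hh : Om -> R).
Hypothesis hh_le : forall w, Rabs (hh w) <= 1.
Variables (d : nat) (E D : Fin.t d -> Om -> R -> R).
Variables (c : Fin.t d -> nat -> R) (J : Fin.t d -> Fin.t d -> nat -> R).

Local Notation P := (jacobian_poly hh J).

(* E and D are the stage error and the induced error in f; c and J hold the Taylor
   coefficients at t0 of f and of its Jacobian along the exact solution. *)
Hypothesis D_bounded : forall i, BigO Om hh 0 (D i).
Hypothesis D_int : forall i w, ex01 (D i w).
Hypothesis AD_int : forall i w tau, 0 <= tau <= 1 -> ex01 (fun s => Abar tau s * D i w s).
Hypothesis E_expand : forall i, BigO Om hh 6 (fun w s => E i w s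
  - hh w ^ 2 * (c i 0%nat * defect Abar 0 s + c i 1%nat * (hh w * defect Abar 1 s)
                + c i 2%nat * (hh w ^ 2 * defect Abar 2 s) + c i 3%nat * (hh w ^ 3 * defect Abar 3 s))
  - hh w ^ 2 * Aop Abar (D i w) s).
Hypothesis D_expand : forall p, (p <= 3)%nat -> (forall j, BigO Om hh p (E j)) ->
  forall i, BigO Om hh (2 * p) (fun w s => D i w s - vsum (fun j => P i j w s * E j w s)).

Lemma BigO_hh : BigO Om hh 0 (fun w _ => hh w).
Proof.
apply (BigO_ext _ _ 0 (fun w _ => hh w ^ 1)); [intros; ring|now apply BigO_step].
Qed.

Lemma BigO_id : BigO Om hh 0 (fun _ s => s).
Proof.
apply (BigO_ext _ _ 0 (fun w s => s ^ 1)); [intros; ring|apply BigO_fun, cont01_pow].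
Qed.

Lemma cont01_def (k : nat) : cont01 (defect Abar k).
Proof. now apply (cont01_defect alpha). Qed.

Local Hint Resolve BigO_hh BigO_id cont01_def : core.
Ltac bnd := pose proof BigO_hh; pose proof BigO_id; bigO0.

Lemma P_bounded (i j : Fin.t d) : BigO Om hh 0 (P i j).
Proof.
apply (BigO_ext _ _ 0 (fun w s => J i j 0%nat + J i j 1%nat * (s * hh w)
   + J i j 2%nat * (s ^ 2 * hh w ^ 2))); [intros; unfold jacobian_poly; ring|].
bnd.
Qed.

Lemma AD_BigO (n : nat) (i : Fin.t d) : BigO Om hh n (D i) -> BigO Om hh n (fun w => Aop Abar (D i w)).
Proof. apply BigO_Aop; [now apply (kernel_bounded alpha)|intros; now apply AD_int]. Qed.

Lemma E_BigO2 (i : Fin.t d) : BigO Om hh 2 (E i).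
Proof.
apply (BigO_ext _ _ 2 (fun w s => (E i w s
  - hh w ^ 2 * (c i 0%nat * defect Abar 0 s + c i 1%nat * (hh w * defect Abar 1 s)
                + c i 2%nat * (hh w ^ 2 * defect Abar 2 s) + c i 3%nat * (hh w ^ 3 * defect Abar 3 s))
  - hh w ^ 2 * Aop Abar (D i w) s)
  + (hh w ^ 2 * (c i 0%nat * defect Abar 0 s + c i 1%nat * (hh w * defect Abar 1 s)
                + c i 2%nat * (hh w ^ 2 * defect Abar 2 s) + c i 3%nat * (hh w ^ 3 * defect Abar 3 s))
     + hh w ^ 2 * Aop Abar (D i w) s))); [intros; ring|].
apply BigO_plus; [apply (BigO_weaken _ _ hh_le 2 6); [lia|apply E_expand]|].
apply BigO_plus; apply BigO_h_bounded; [bnd|].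
now apply AD_BigO.
Qed.

Lemma D_of_E (p : nat) (i : Fin.t d) : (p <= 3)%nat -> (forall j, BigO Om hh p (E j)) ->
  BigO Om hh p (D i).
Proof.
intros Hp HE.
apply (BigO_ext _ _ p (fun w s => (D i w s - vsum (fun j => P i j w s * E j w s))
   + vsum (fun j => P i j w s * E j w s))); [intros; ring|].
apply BigO_plus; [apply (BigO_weaken _ _ hh_le p (2 * p)); [lia|now apply D_expand]|].
apply (BigO_lsum _ _ (fins d) p (fun j w s => P i j w s * E j w s)).
intros j; apply BigO_mult0; [apply P_bounded|apply HE].
Qed.

(** Two replacements modulo O(h^n): E by an explicit expansion [e], then the product P e by the part
    [m] of it that still counts. *)
Lemma D_main (n : nat) (i : Fin.t d) (e m : Fin.t d -> Om -> R -> R) :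
  BigO Om hh n (fun w s => D i w s - vsum (fun j => P i j w s * E j w s)) ->
  (forall j, BigO Om hh n (fun w s => E j w s - e j w s)) ->
  (forall j, BigO Om hh n (fun w s => P i j w s * e j w s - m j w s)) ->
  BigO Om hh n (fun w s => D i w s - vsum (fun j => m j w s)).
Proof.
intros HD He Hm.
apply (BigO_ext _ _ n (fun w s => (D i w s - vsum (fun j => P i j w s * E j w s))
  + vsum (fun j => P i j w s * (E j w s - e j w s) + (P i j w s * e j w s - m j w s)))).
- intros w s _. unfold vsum.
  rewrite (lsum_ext _ (fun j => P i j w s * (E j w s - e j w s) + (P i j w s * e j w s - m j w s))
    (fun j => P i j w s * E j w s - m j w s)), lsum_minus by (intros; ring). ring.
- apply BigO_plus; [assumption|].
  apply (BigO_lsum _ _ (fins d) n (fun j w s => P i j w s * (E j w s - e j w s)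
     + (P i j w s * e j w s - m j w s))).
  intros j; apply BigO_plus; [apply BigO_mult0; [apply P_bounded|apply He]|apply Hm].
Qed.

(** The prefactors h^2 and h of the two updates turn both bounds into h^(p+1). *)
Definition quadrature_order (p : nat) : Prop := forall i : Fin.t d, exists K, 0 <= K /\ forall w,
  Rabs (I01 (fun s => (1 - s) * D i w s)) <= K * Rabs (hh w) ^ (p - 1) /\
  Rabs (I01 (fun s => 1 * D i w s)) <= K * Rabs (hh w) ^ p.

Hypothesis BD_int : forall i w, ex01 (fun s => (1 - s) * D i w s).

(** The weights 1 - s and 1 get separate main parts: the position needs one power of h less, so its
    main part can be shorter. *)
Lemma quadrature_order_main (p : nat) :
  (forall i, exists m, BigO Om hh (p - 1) (fun w s => D i w s - m w s)
     /\ forall w, null01 (fun s => (1 - s) * m w s)) ->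
  (forall i, exists m, BigO Om hh p (fun w s => D i w s - m w s) /\ forall w, null01 (m w)) ->
  quadrature_order p.
Proof.
intros H1 H2 i; destruct (H1 i) as [m1 [B1 N1]], (H2 i) as [m2 [B2 N2]].
destruct (I01_BigO Om hh (p - 1) (fun s => 1 - s) (D i) m1) as [K1 [P1 C1]]; try assumption.
{ apply cont01_minus; [apply cont01_const|].
  apply (cont01_ext (fun x => x ^ 1)); [intros; ring|apply cont01_pow]. }
{ intros; apply BD_int. }
destruct (I01_BigO Om hh p (fun _ => 1) (D i) m2) as [K2 [P2 C2]]; try assumption.
{ apply cont01_const. }
{ intros; now apply ex01_scal. }
{ intros w; now apply null01_scal. }
exists (K1 + K2); split; [lra|]; intros w; split.
- eapply Rle_trans; [apply C1|]; apply Rmult_le_compat_r; [apply pow_le, Rabs_pos|lra].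
- eapply Rle_trans; [apply C2|]; apply Rmult_le_compat_r; [apply pow_le, Rabs_pos|lra].
Qed.

Lemma null01_zero : null01 (fun _ => 0).
Proof. split; [apply ex01_const|apply I01_const]. Qed.

Lemma expansion_order2 : quadrature_order 2.
Proof.
apply quadrature_order_main; intros i; exists (fun _ _ => 0);
  (split; [|intros w; try apply (null01_ext (fun _ => 0)); auto using null01_zero; intros; ring]).
- apply (BigO_weaken _ _ hh_le 1 2); [lia|].
  apply BigO_minus; [apply D_of_E; [lia|apply E_BigO2]|apply BigO_zero].
- apply BigO_minus; [apply D_of_E; [lia|apply E_BigO2]|apply BigO_zero].
Qed.

Lemma null01_defect (a k : nat) :
  I01 (fun x => x ^ a * defect Abar k x) = 0 -> null01 (fun x => x ^ a * defect Abar k x).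
Proof.
intros H; split; [|assumption]; apply cont01_ex01, cont01_mult; [apply cont01_pow|auto].
Qed.

Lemma null01_minus (f g : R -> R) : null01 f -> null01 g -> null01 (fun x => f x - g x).
Proof.
intros [Hf If] [Hg Ig]; split; [now apply ex01_minus|rewrite I01_minus, If, Ig by assumption; ring].
Qed.

Ltac null :=
  first [ assumption
        | lazymatch goal with
          | |- null01 (fun s => @?a s + @?b s) => apply (null01_plus a b); null
          | |- null01 (fun s => @?a s - @?b s) => apply (null01_minus a b); null
          | |- null01 (fun s => ?k * @?b s) => apply (null01_scal k b); null
          end ].

(** From E = O(h^2) and D = O(h^2) the feedback h^2 int Abar D is O(h^4), so below h^4 only e_0 and
    e_1 are present in E. *)
Lemma expansion_order4 : alpha 0%nat 0%nat = 1 / 6 -> quadrature_order 4.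
Proof.
intros a00.
assert (N00 := null01_defect _ _ (defect_0_0 alpha Abar kernel a00)).
assert (N10 := null01_defect _ _ (defect_1_0 alpha Abar kernel a00)).
assert (N01 := null01_defect _ _ (defect_0_1 alpha Abar kernel a00)).
set (e := fun j w s => hh w ^ 2 * (c j 0%nat * defect Abar 0 s + c j 1%nat * (hh w * defect Abar 1 s))).
assert (HD2 : forall i, BigO Om hh 2 (D i)) by (intros; apply D_of_E; [lia|apply E_BigO2]).
assert (HE : forall j, BigO Om hh 4 (fun w s => E j w s - e j w s)).
{ intros j.
  apply (BigO_ext _ _ 4 (fun w s => (E j w s
    - hh w ^ 2 * (c j 0%nat * defect Abar 0 s + c j 1%nat * (hh w * defect Abar 1 s)
                + c j 2%nat * (hh w ^ 2 * defect Abar 2 s) + c j 3%nat * (hh w ^ 3 * defect Abar 3 s))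
    - hh w ^ 2 * Aop Abar (D j w) s)
    + (hh w ^ 2 * Aop Abar (D j w) s
       + hh w ^ 4 * (c j 2%nat * defect Abar 2 s + c j 3%nat * (hh w * defect Abar 3 s)))));
    [intros; unfold e; ring|].
  apply BigO_plus; [apply (BigO_weaken _ _ hh_le 4 6); [lia|apply E_expand]|].
  apply BigO_plus; [apply (BigO_h_mult _ _ 2 2), AD_BigO, HD2|apply BigO_h_bounded; bnd]. }
assert (HD : forall i, BigO Om hh 4 (fun w s => D i w s - vsum (fun j => P i j w s * E j w s)))
  by (intros; apply (D_expand 2); [lia|apply E_BigO2]).
apply quadrature_order_main; intros i.
(* For the position an error O(h^3) suffices, so the h^2 term is the whole main part. *)
- exists (fun w s => vsum (fun j => hh w ^ 2 * (J i j 0%nat * c j 0%nat * (s ^ 0 * defect Abar 0 s)))).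
  split.
  + apply D_main with e.
    * now apply (BigO_weaken _ _ hh_le 3 4); [lia|].
    * intros j; now apply (BigO_weaken _ _ hh_le 3 4 (fun w s => E j w s - e j w s)); [lia|].
    * intros j; apply (BigO_ext _ _ 3 (fun w s => hh w ^ 3 * (J i j 0%nat * (c j 1%nat * defect Abar 1 s)
         + (J i j 1%nat * s + J i j 2%nat * (s ^ 2 * hh w))
           * (c j 0%nat * defect Abar 0 s + c j 1%nat * (hh w * defect Abar 1 s)))));
      [intros; unfold jacobian_poly, e; ring|].
      apply BigO_h_bounded; bnd.
  (* The weight 1 - s turns each term into a difference of two consecutive moments. *)
  + intros w; apply (null01_ext (fun s => vsum (fun j => hh w ^ 2 * (J i j 0%nat * c j 0%nat *
       (s ^ 0 * defect Abar 0 s - s ^ 1 * defect Abar 0 s))))).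
    * intros s; unfold vsum; rewrite <- lsum_scal; apply lsum_ext; intros; ring.
    * apply (null01_lsum (fins d) (fun j s => hh w ^ 2 * (J i j 0%nat * c j 0%nat *
         (s ^ 0 * defect Abar 0 s - s ^ 1 * defect Abar 0 s)))); intros j; null.
- exists (fun w s => vsum (fun j => hh w ^ 2 * (J i j 0%nat * c j 0%nat * (s ^ 0 * defect Abar 0 s))
     + hh w ^ 3 * (J i j 0%nat * c j 1%nat * (s ^ 0 * defect Abar 1 s)
                   + J i j 1%nat * c j 0%nat * (s ^ 1 * defect Abar 0 s)))).
  split.
  + apply D_main with e; [apply HD|apply HE|].
    intros j; apply (BigO_ext _ _ 4 (fun w s => hh w ^ 4 * (J i j 1%nat * (s * (c j 1%nat * defect Abar 1 s))
         + J i j 2%nat * s ^ 2 * (c j 0%nat * defect Abar 0 s + c j 1%nat * (hh w * defect Abar 1 s)))));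
      [intros; unfold jacobian_poly, e; ring|].
    apply BigO_h_bounded; bnd.
  + intros w; apply (null01_lsum (fins d) (fun j s => hh w ^ 2 * (J i j 0%nat * c j 0%nat * (s ^ 0 * defect Abar 0 s))
     + hh w ^ 3 * (J i j 0%nat * c j 1%nat * (s ^ 0 * defect Abar 1 s)
                   + J i j 1%nat * c j 0%nat * (s ^ 1 * defect Abar 0 s)))); intros j; null.
Qed.

Lemma Aop_linear (i : Fin.t d) (x : R) (w : Om) (tau : R) : 0 <= tau <= 1 ->
  Aop Abar (fun s => D i w s - x * defect Abar 1 s) tau
  = Aop Abar (D i w) tau - x * Aop Abar (defect Abar 1) tau.
Proof.
intros Ht; unfold Aop.
assert (X : ex01 (fun s => Abar tau s * defect Abar 1 s))
  by (apply cont01_ex01, cont01_mult; [now apply (cont01_kernel alpha)|auto]).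
rewrite <- I01_scal, <- I01_minus by auto using ex01_scal.
apply I01_ext; intros; ring.
Qed.

(** Vanishing of e_0 gives E = O(h^3), so f_q E represents D up to O(h^6). What remains is the
    feedback of D into E, which is resolved by alternately refining the two expansions. *)
Lemma expansion_order6 :
  alpha 0%nat 0%nat = 1 / 6 -> alpha 1%nat 1%nat = - (1 / 10) ->
  alpha 2%nat 0%nat = sqrt 5 / 60 -> alpha 0%nat 2%nat = sqrt 5 / 60 ->
  (forall i : nat, (2 < i)%nat -> Nat.even i = true -> alpha i 0%nat = 0) ->
  quadrature_order 6.
Proof.
intros a00 a11 a20 a02 ai0.
assert (N01 := null01_defect _ _ (defect_0_1 alpha Abar kernel a00)).
assert (N11 := null01_defect _ _ (defect_1_1 alpha Abar kernel a00 a11)).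
assert (N21 := null01_defect _ _ (defect_2_1 alpha Abar kernel a00 a11 a20)).
assert (N02 := null01_defect _ _ (defect_0_2 alpha Abar kernel a00 a02)).
assert (N12 := null01_defect _ _ (defect_1_2 alpha Abar kernel a00 a11 a02)).
assert (N03 := null01_defect _ _ (defect_0_3 alpha Abar kernel a00 a02)).
assert (Z : forall s, 0 <= s <= 1 -> defect Abar 0 s = 0)
  by (intros; now apply (defect_0_eq alpha)).
set (G := Aop Abar (defect Abar 1)).
assert (CG : cont01 G) by (apply (cont01_Aop alpha); auto).
assert (NG : null01 (fun x => x ^ 0 * G x)).
{ split; [apply cont01_ex01, cont01_mult; [apply cont01_pow|assumption]|].
  now apply (Aop_defect_1 alpha). }
assert (HD2 : forall i, BigO Om hh 2 (D i)) by (intros; apply D_of_E; [lia|apply E_BigO2]).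
(* The h^2 term is absent since e_0 = 0, and the feedback is O(h^4). *)
assert (HE3 : forall j, BigO Om hh 3 (E j)).
{ intros j.
  apply (BigO_ext _ _ 3 (fun w s => (E j w s
    - hh w ^ 2 * (c j 0%nat * defect Abar 0 s + c j 1%nat * (hh w * defect Abar 1 s)
                + c j 2%nat * (hh w ^ 2 * defect Abar 2 s) + c j 3%nat * (hh w ^ 3 * defect Abar 3 s))
    - hh w ^ 2 * Aop Abar (D j w) s)
    + (hh w ^ 2 * Aop Abar (D j w) s
       + hh w ^ 3 * (c j 1%nat * defect Abar 1 s + c j 2%nat * (hh w * defect Abar 2 s)
                     + c j 3%nat * (hh w ^ 2 * defect Abar 3 s)))));
    [intros w s Hs; rewrite (Z s Hs); ring|].
  apply BigO_plus; [apply (BigO_weaken _ _ hh_le 3 6); [lia|apply E_expand]|].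
  apply BigO_plus; [|apply BigO_h_bounded; bnd].
  apply (BigO_weaken _ _ hh_le 3 4); [lia|apply (BigO_h_mult _ _ 2 2), AD_BigO, HD2]. }
assert (HD : forall i, BigO Om hh 6 (fun w s => D i w s - vsum (fun j => P i j w s * E j w s)))
  by (intros; apply (D_expand 3); auto).
assert (HD3 : forall i, BigO Om hh 3 (D i)) by (intros; apply D_of_E; [lia|assumption]).
(* With D = O(h^3) the feedback moves to h^5, so E is explicit below that power. *)
assert (HE5 : forall j, BigO Om hh 5 (fun w s => E j w s
   - hh w ^ 3 * (c j 1%nat * defect Abar 1 s + c j 2%nat * (hh w * defect Abar 2 s)))).
{ intros j.
  apply (BigO_ext _ _ 5 (fun w s => (E j w s
    - hh w ^ 2 * (c j 0%nat * defect Abar 0 s + c j 1%nat * (hh w * defect Abar 1 s)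
                + c j 2%nat * (hh w ^ 2 * defect Abar 2 s) + c j 3%nat * (hh w ^ 3 * defect Abar 3 s))
    - hh w ^ 2 * Aop Abar (D j w) s)
    + (hh w ^ 2 * Aop Abar (D j w) s + hh w ^ 5 * (c j 3%nat * defect Abar 3 s))));
    [intros w s Hs; rewrite (Z s Hs); ring|].
  apply BigO_plus; [apply (BigO_weaken _ _ hh_le 5 6); [lia|apply E_expand]|].
  apply BigO_plus; [apply (BigO_h_mult _ _ 3 2), AD_BigO, HD3|apply BigO_h_bounded; bnd]. }
(* The Jacobian at t0 applied to the coefficient c_1: D equals h^3 x e_1 up to O(h^4). *)
set (x := fun i => vsum (fun j => J i j 0%nat * c j 1%nat)).
assert (HD4 : forall i, BigO Om hh 4 (fun w s => D i w s - hh w ^ 3 * x i * defect Abar 1 s)).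
{ intros i.
  apply (BigO_ext _ _ 4 (fun w s => D i w s
     - vsum (fun j => hh w ^ 3 * defect Abar 1 s * (J i j 0%nat * c j 1%nat)))).
  { intros w s _; unfold vsum; rewrite lsum_scal; unfold x, vsum; ring. }
  apply D_main with (fun j w s => hh w ^ 3 * (c j 1%nat * defect Abar 1 s
                                              + c j 2%nat * (hh w * defect Abar 2 s))).
  - apply (BigO_weaken _ _ hh_le 4 6); [lia|apply HD].
  - intros j; apply (BigO_weaken _ _ hh_le 4 5); [lia|apply HE5].
  - intros j; apply (BigO_ext _ _ 4 (fun w s => hh w ^ 4 * (J i j 0%nat * (c j 2%nat * defect Abar 2 s)
      + (J i j 1%nat * s + J i j 2%nat * (s ^ 2 * hh w))
        * (c j 1%nat * defect Abar 1 s + c j 2%nat * (hh w * defect Abar 2 s)))));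
      [intros; unfold jacobian_poly; ring|].
    apply BigO_h_bounded; bnd. }
assert (HA4 : forall i, BigO Om hh 4 (fun w s => Aop Abar (D i w) s - hh w ^ 3 * x i * G s)).
{ intros i. apply (BigO_ext _ _ 4 (fun w => Aop Abar (fun s => D i w s - hh w ^ 3 * x i * defect Abar 1 s))).
  { intros w s Hs; now rewrite Aop_linear. }
  apply BigO_Aop; [now apply (kernel_bounded alpha)| |apply HD4].
  intros w tau Ht.
  apply (ex01_ext (fun s => Abar tau s * D i w s - hh w ^ 3 * x i * (Abar tau s * defect Abar 1 s)));
    [intros; ring|].
  apply ex01_minus; [now apply AD_int|].
  apply ex01_scal, cont01_ex01, cont01_mult; [now apply (cont01_kernel alpha)|auto]. }
(* Inserting the leading term of D into the feedback adds h^5 x G, with G the kernel applied to e_1;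
   now E is known up to O(h^6). *)
set (e := fun j w s => hh w ^ 3 * (c j 1%nat * defect Abar 1 s + c j 2%nat * (hh w * defect Abar 2 s)
            + hh w ^ 2 * (c j 3%nat * defect Abar 3 s + x j * G s))).
assert (HE : forall j, BigO Om hh 6 (fun w s => E j w s - e j w s)).
{ intros j.
  apply (BigO_ext _ _ 6 (fun w s => (E j w s
    - hh w ^ 2 * (c j 0%nat * defect Abar 0 s + c j 1%nat * (hh w * defect Abar 1 s)
                + c j 2%nat * (hh w ^ 2 * defect Abar 2 s) + c j 3%nat * (hh w ^ 3 * defect Abar 3 s))
    - hh w ^ 2 * Aop Abar (D j w) s)
    + hh w ^ 2 * (Aop Abar (D j w) s - hh w ^ 3 * x j * G s)));
    [intros w s Hs; unfold e; rewrite (Z s Hs); ring|].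
  apply BigO_plus; [apply E_expand|apply (BigO_h_mult _ _ 4 2), HA4]. }
apply quadrature_order_main; intros i.
- exists (fun w s => vsum (fun j => hh w ^ 3 * (J i j 0%nat * c j 1%nat * (s ^ 0 * defect Abar 1 s))
     + hh w ^ 4 * (J i j 0%nat * c j 2%nat * (s ^ 0 * defect Abar 2 s)
                   + J i j 1%nat * c j 1%nat * (s ^ 1 * defect Abar 1 s)))).
  split.
  + apply D_main with e.
    * apply (BigO_weaken _ _ hh_le 5 6); [lia|apply HD].
    * intros j; apply (BigO_weaken _ _ hh_le 5 6); [lia|apply HE].
    * intros j; apply (BigO_ext _ _ 5 (fun w s => hh w ^ 5 *
         (J i j 0%nat * (c j 3%nat * defect Abar 3 s + x j * G s)
          + J i j 1%nat * (s * (c j 2%nat * defect Abar 2 s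
                           + hh w * (c j 3%nat * defect Abar 3 s + x j * G s)))
          + J i j 2%nat * (s ^ 2 * (c j 1%nat * defect Abar 1 s + c j 2%nat * (hh w * defect Abar 2 s)
            + hh w ^ 2 * (c j 3%nat * defect Abar 3 s + x j * G s))))));
      [intros; unfold jacobian_poly, e; ring|].
      apply BigO_h_bounded; bnd.
  + intros w; apply (null01_ext (fun s => vsum (fun j =>
       hh w ^ 3 * (J i j 0%nat * c j 1%nat * (s ^ 0 * defect Abar 1 s - s ^ 1 * defect Abar 1 s))
     + hh w ^ 4 * (J i j 0%nat * c j 2%nat * (s ^ 0 * defect Abar 2 s - s ^ 1 * defect Abar 2 s)
                   + J i j 1%nat * c j 1%nat * (s ^ 1 * defect Abar 1 s - s ^ 2 * defect Abar 1 s))))).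
    * intros s; unfold vsum; rewrite <- lsum_scal; apply lsum_ext; intros; ring.
    * apply (null01_lsum (fins d) (fun j s =>
       hh w ^ 3 * (J i j 0%nat * c j 1%nat * (s ^ 0 * defect Abar 1 s - s ^ 1 * defect Abar 1 s))
     + hh w ^ 4 * (J i j 0%nat * c j 2%nat * (s ^ 0 * defect Abar 2 s - s ^ 1 * defect Abar 2 s)
                   + J i j 1%nat * c j 1%nat * (s ^ 1 * defect Abar 1 s - s ^ 2 * defect Abar 1 s))));
      intros j; null.
(* At h^5 the combinations s^0 e_3, s e_2 and s^2 e_1 appear together with G, the only term whose
   integral is not a moment of some e_k. *)
- exists (fun w s => vsum (fun j => hh w ^ 3 * (J i j 0%nat * c j 1%nat * (s ^ 0 * defect Abar 1 s))
     + hh w ^ 4 * (J i j 0%nat * c j 2%nat * (s ^ 0 * defect Abar 2 s)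
                   + J i j 1%nat * c j 1%nat * (s ^ 1 * defect Abar 1 s))
     + hh w ^ 5 * (J i j 0%nat * (c j 3%nat * (s ^ 0 * defect Abar 3 s) + x j * (s ^ 0 * G s))
                   + J i j 1%nat * c j 2%nat * (s ^ 1 * defect Abar 2 s)
                   + J i j 2%nat * c j 1%nat * (s ^ 2 * defect Abar 1 s)))).
  split.
  + apply D_main with e; [apply HD|apply HE|].
    intros j; apply (BigO_ext _ _ 6 (fun w s => hh w ^ 6 *
         (J i j 1%nat * (s * (c j 3%nat * defect Abar 3 s + x j * G s))
          + J i j 2%nat * (s ^ 2 * (c j 2%nat * defect Abar 2 s
            + hh w * (c j 3%nat * defect Abar 3 s + x j * G s))))));
      [intros; unfold jacobian_poly, e; ring|].
    apply BigO_h_bounded; bnd.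
  + intros w; apply (null01_lsum (fins d) (fun j s =>
       hh w ^ 3 * (J i j 0%nat * c j 1%nat * (s ^ 0 * defect Abar 1 s))
     + hh w ^ 4 * (J i j 0%nat * c j 2%nat * (s ^ 0 * defect Abar 2 s)
                   + J i j 1%nat * c j 1%nat * (s ^ 1 * defect Abar 1 s))
     + hh w ^ 5 * (J i j 0%nat * (c j 3%nat * (s ^ 0 * defect Abar 3 s) + x j * (s ^ 0 * G s))
                   + J i j 1%nat * c j 2%nat * (s ^ 1 * defect Abar 2 s)
                   + J i j 2%nat * c j 1%nat * (s ^ 2 * defect Abar 1 s)))); intros j; null.
Qed.

End Expansion.

(** * Application to the method *)

Lemma Ck_weaken {d : nat} (k : nat) : forall g : R -> Vec d -> R, Ck (S k) g -> Ck k g.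
Proof.
induction k as [|k IH]; intros g Hg; [exact (proj1 Hg)|].
destruct Hg as [H0 [[gt [Ht Ct]] [gx [Hx Cx]]]]; split; [assumption|]; split.
- exists gt; auto.
- exists gx; auto.
Qed.

(* The index set over which all O-constants have to be uniform. *)
Record step_of (Abar : R -> R -> R) {d : nat} (f : R -> Vec d -> Vec d) (t0 : R) (q0 v0 : Vec d)
  (rho M : R) : Type := Step {
  st_h : R;
  st_Q : R -> Vec d;
  st_q1 : Vec d;
  st_v1 : Vec d;
  st_small : Rabs st_h <= rho;
  st_step : csrkn_step Abar (fun tau => 1 - tau) (fun _ => 1) (fun tau => tau)
              f t0 st_h q0 v0 st_Q st_q1 st_v1;
  st_box : forall tau, 0 <= tau <= 1 -> forall i, Rabs (st_Q tau i - q0 i) <= M }.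

Arguments st_h {Abar d f t0 q0 v0 rho M}.
Arguments st_Q {Abar d f t0 q0 v0 rho M}.
Arguments st_q1 {Abar d f t0 q0 v0 rho M}.
Arguments st_v1 {Abar d f t0 q0 v0 rho M}.
Arguments st_small {Abar d f t0 q0 v0 rho M}.
Arguments st_step {Abar d f t0 q0 v0 rho M}.
Arguments st_box {Abar d f t0 q0 v0 rho M}.

Section Method.
Variables (alpha : nat -> nat -> R) (Abar : R -> R -> R).
Hypothesis kernel : legendre_kernel alpha Abar.
Variables (d : nat) (f : R -> Vec d -> Vec d) (t0 : R) (q0 v0 : Vec d) (r rho M : R) (q v : R -> Vec d).
Hypothesis smooth_f : smooth f.
Hypothesis rho_r : rho < r.
Hypothesis rho_1 : rho <= 1.
Hypothesis q_deriv : forall t, t0 - r < t < t0 + r -> forall i, is_derive (fun s => q s i) t (v t i).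
Hypothesis v_deriv : forall t, t0 - r < t < t0 + r -> forall i,
  is_derive (fun s => v s i) t (f t (q t) i).
Hypothesis q_init : q t0 = q0.
Hypothesis v_init : v t0 = v0.

Let Om := step_of Abar f t0 q0 v0 rho M.
Let hh : Om -> R := st_h.
Let phi (i : Fin.t d) (w : Om) (s : R) : R := f (t0 + s * hh w) (q (t0 + s * hh w)) i.
Let F (i : Fin.t d) (w : Om) (s : R) : R := f (t0 + s * hh w) (st_Q w s) i.
Let D (i : Fin.t d) (w : Om) (s : R) : R := F i w s - phi i w s.
Let E (i : Fin.t d) (w : Om) (s : R) : R := st_Q w s i - q (t0 + s * hh w) i.

Lemma hh_small (w : Om) : Rabs (hh w) <= rho.
Proof. exact (st_small w). Qed.

Lemma hh_le_1 (w : Om) : Rabs (hh w) <= 1.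
Proof. eapply Rle_trans; [apply hh_small|exact rho_1]. Qed.

Lemma sh_le (w : Om) (s : R) : 0 <= s <= 1 -> Rabs (s * hh w) <= Rabs (hh w).
Proof.
intros Hs; rewrite Rabs_mult, (Rabs_pos_eq s) by lra.
generalize (Rabs_pos (hh w)); nra.
Qed.

Lemma sh_rho (w : Om) (s : R) : 0 <= s <= 1 -> Rabs (s * hh w) <= rho.
Proof. intros Hs; eapply Rle_trans; [now apply sh_le|apply hh_small]. Qed.

Lemma time_in (u : R) : Rabs u <= rho -> t0 - r < t0 + u < t0 + r.
Proof. intros H; apply Rabs_le_between in H; lra. Qed.

Lemma continuous_phi (i : Fin.t d) (w : Om) (s : R) : 0 <= s <= 1 -> continuous (phi i w) s.
Proof.
intros Hs; apply (continuous_comp (fun s => t0 + s * hh w) (fun t => f t (q t) i)).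
- apply @ex_derive_continuous; auto_derive; easy.
- apply (Cn_trajectory d f (t0 - r) (t0 + r) q v smooth_f q_deriv v_deriv 0 (fun t x => f t x i)).
  + apply smooth_f.
  + apply time_in; now apply sh_rho.
Qed.

Lemma cont01_phi (i : Fin.t d) (w : Om) : cont01 (phi i w).
Proof. apply cont01_continuous; intros; now apply continuous_phi. Qed.

(** No continuity of the stages is available; integrability of f along them is extracted from the
    velocity update, whose weight is 1. *)
Lemma ex01_F (i : Fin.t d) (w : Om) : ex01 (F i w).
Proof.
destruct (st_step w) as [_ [_ S]]; destruct (S i) as [I [HI _]].
apply integral01_I01 in HI; destruct HI as [X _].
apply (ex01_ext (fun s => 1 * f (t0 + s * st_h w) (st_Q w s) i)); [|exact X].
intros; unfold F, hh; ring.
Qed.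

Lemma ex01_D (i : Fin.t d) (w : Om) : ex01 (D i w).
Proof. apply ex01_minus; [apply ex01_F|apply cont01_ex01, cont01_phi]. Qed.

Lemma ex01_AF (i : Fin.t d) (w : Om) (tau : R) : 0 <= tau <= 1 ->
  ex01 (fun s => Abar tau s * F i w s) /\
  st_Q w tau i = q0 i + hh w * tau * v0 i + hh w ^ 2 * Aop Abar (F i w) tau.
Proof.
intros Ht; destruct (st_step w) as [S _]; destruct (S tau Ht i) as [I [HI EQ]].
apply integral01_I01 in HI; destruct HI as [X <-]; now split.
Qed.

Lemma ex01_Aphi (i : Fin.t d) (w : Om) (tau : R) : 0 <= tau <= 1 ->
  ex01 (fun s => Abar tau s * phi i w s).
Proof.
intros; apply cont01_ex01, cont01_mult; [now apply (cont01_kernel alpha)|apply cont01_phi].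
Qed.

Lemma ex01_AD (i : Fin.t d) (w : Om) (tau : R) : 0 <= tau <= 1 ->
  ex01 (fun s => Abar tau s * D i w s).
Proof.
intros Ht.
apply (ex01_ext (fun s => Abar tau s * F i w s - Abar tau s * phi i w s)); [intros; unfold D; ring|].
apply ex01_minus; [now apply ex01_AF|now apply ex01_Aphi].
Qed.

Lemma Aop_F (i : Fin.t d) (w : Om) (tau : R) : 0 <= tau <= 1 ->
  Aop Abar (F i w) tau = Aop Abar (phi i w) tau + Aop Abar (D i w) tau.
Proof.
intros Ht; unfold Aop; rewrite <- I01_plus; [|now apply ex01_Aphi|now apply ex01_AD].
apply I01_ext; intros; unfold D; ring.
Qed.

Lemma cont01_one_minus : cont01 (fun s => 1 - s).
Proof.
apply cont01_minus; [apply cont01_const|].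
apply (cont01_ext (fun s => s ^ 1)); [intros; ring|apply cont01_pow].
Qed.

Lemma ex01_BF (i : Fin.t d) (w : Om) :
  ex01 (fun s => (1 - s) * F i w s) /\
  st_q1 w i = q0 i + hh w * v0 i + hh w ^ 2 * I01 (fun s => (1 - s) * F i w s).
Proof.
destruct (st_step w) as [_ [S _]]; destruct (S i) as [I [HI EQ]].
apply integral01_I01 in HI; destruct HI as [X <-]; now split.
Qed.

Lemma ex01_BD (i : Fin.t d) (w : Om) : ex01 (fun s => (1 - s) * D i w s).
Proof.
apply (ex01_ext (fun s => (1 - s) * F i w s - (1 - s) * phi i w s)); [intros; unfold D; ring|].
apply ex01_minus; [apply ex01_BF|].
apply cont01_ex01, cont01_mult; [apply cont01_one_minus|apply cont01_phi].
Qed.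

Lemma is_derive_along (y : R -> R) (y' : R) (w : Om) (s : R) :
  is_derive y (t0 + s * hh w) y' -> is_derive (fun s => y (t0 + s * hh w)) s (hh w * y').
Proof.
intros H; apply (is_derive_comp y (fun s => t0 + s * hh w)); [assumption|].
auto_derive; [easy|ring].
Qed.

Lemma exact_v (i : Fin.t d) (w : Om) : v (t0 + hh w) i = v0 i + hh w * I01 (fun s => 1 * phi i w s).
Proof.
assert (X : is_RInt (V := R_NormedModule) (fun s => hh w * phi i w s) 0 1
   ((fun s => v (t0 + s * hh w) i) 1 - (fun s => v (t0 + s * hh w) i) 0)).
{ apply (is_RInt_derive (V := R_CompleteNormedModule) (fun s => v (t0 + s * hh w) i)).
  - intros s; rewrite Rmin_left, Rmax_right by lra; intros Hs.
    apply (is_derive_along (fun t => v t i)), v_deriv, time_in; now apply sh_rho.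
  - intros s; rewrite Rmin_left, Rmax_right by lra; intros Hs.
    apply (continuous_scal_r (V := R_NormedModule) (hh w)); now apply continuous_phi. }
apply I01_unique in X; rewrite I01_scal in X by apply cont01_ex01, cont01_phi.
rewrite (I01_ext _ (phi i w)) by (intros; ring).
rewrite X, <- v_init, Rmult_0_l, Rmult_1_l, Rplus_0_r; ring.
Qed.

Lemma exact_q (i : Fin.t d) (w : Om) :
  q (t0 + hh w) i = q0 i + hh w * v0 i + hh w ^ 2 * I01 (fun s => (1 - s) * phi i w s).
Proof.
(* Taylor's formula with integral remainder: the derivative of this function is h^2 (1 - s) phi, the
   h v terms cancelling. *)
set (y := fun s => q (t0 + s * hh w) i + (1 - s) * (hh w * v (t0 + s * hh w) i)).
assert (X : is_RInt (V := R_NormedModule) (fun s => hh w ^ 2 * ((1 - s) * phi i w s)) 0 1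
   (y 1 - y 0)).
{ apply (is_RInt_derive (V := R_CompleteNormedModule) y).
  - intros s; rewrite Rmin_left, Rmax_right by lra; intros Hs.
    assert (T : t0 - r < t0 + s * hh w < t0 + r) by (apply time_in; now apply sh_rho).
    replace (hh w ^ 2 * ((1 - s) * phi i w s)) with
      (hh w * v (t0 + s * hh w) i + (-1 * (hh w * v (t0 + s * hh w) i)
         + (1 - s) * (hh w * (hh w * phi i w s)))) by ring.
    apply (is_derive_plus (V := R_NormedModule) (fun s => q (t0 + s * hh w) i)).
    + now apply (is_derive_along (fun t => q t i)), q_deriv.
    + apply (is_derive_mult (fun s => 1 - s) (fun s => hh w * v (t0 + s * hh w) i));
        [auto_derive; [easy|ring]| |apply Rmult_comm].
      apply is_derive_scal. now apply (is_derive_along (fun t => v t i)), v_deriv.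
  - intros s; rewrite Rmin_left, Rmax_right by lra; intros Hs.
    apply (continuous_scal_r (V := R_NormedModule) (hh w ^ 2)).
    apply (continuous_mult (fun s => 1 - s)); [|now apply continuous_phi].
    apply @ex_derive_continuous; auto_derive; easy. }
apply I01_unique in X; rewrite I01_scal in X
  by (apply cont01_ex01, cont01_mult; [apply cont01_one_minus|apply cont01_phi]).
rewrite X; unfold y; rewrite <- q_init, <- v_init, Rmult_0_l, Rmult_1_l, Rplus_0_r; ring.
Qed.

Lemma order_of_quadrature (p : nat) : (1 <= p)%nat -> 0 < rho ->
  quadrature_order Om hh d D p ->
  exists K h1, 0 < h1 /\ forall h Q q1 v1, Rabs h < h1 ->
    csrkn_step Abar (fun tau => 1 - tau) (fun _ => 1) (fun tau => tau) f t0 h q0 v0 Q q1 v1 ->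
    (forall tau, 0 <= tau <= 1 -> forall i, Rabs (Q tau i - q0 i) <= M) ->
    forall i,
      Rabs (q (t0 + h) i - q1 i) <= K * Rabs h ^ (p + 1) /\
      Rabs (v (t0 + h) i - v1 i) <= K * Rabs h ^ (p + 1).
Proof.
intros Hp Hrho HQ; destruct (functional_choice _ HQ) as [K HK].
exists (vsum K), rho; split; [assumption|].
intros h Q q1 v1 Hh Hstep Hbox i.
(* The given step becomes one index of the family, so the constants do not depend on it. *)
set (w := Step Abar d f t0 q0 v0 rho M h Q q1 v1 (Rlt_le _ _ Hh) Hstep Hbox : Om).
destruct (HK i) as [K0 HKi]; destruct (HKi w) as [H1 H2].
assert (Ki : K i <= vsum K) by (apply vsum_term_le; intros; apply HK).
assert (P : 0 <= Rabs h ^ (p + 1)) by (apply pow_le, Rabs_pos).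
change (hh w) with h in H1, H2.
split; (apply Rle_trans with (K i * Rabs h ^ (p + 1)); [|now apply Rmult_le_compat_r]).
- assert (Eq : q (t0 + h) i - q1 i = h ^ 2 * - I01 (fun s => (1 - s) * D i w s)).
  { assert (Ex := exact_q i w); change (hh w) with h in Ex; rewrite Ex.
    destruct (ex01_BF i w) as [X EF]; change (st_q1 w) with q1 in EF; change (hh w) with h in EF.
    rewrite EF, (I01_ext (fun s => (1 - s) * D i w s)
      (fun s => (1 - s) * F i w s - (1 - s) * phi i w s)) by (intros; unfold D; ring).
    rewrite I01_minus; [ring|assumption|].
    apply cont01_ex01, cont01_mult; [apply cont01_one_minus|apply cont01_phi]. }
  rewrite Eq, Rabs_mult, Rabs_Ropp, <- RPow_abs.
  replace (p + 1)%nat with (2 + (p - 1))%nat by lia; rewrite pow_add.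
  rewrite (Rmult_comm (K i)), Rmult_assoc, (Rmult_comm _ (K i)).
  apply Rmult_le_compat_l; [apply pow_le, Rabs_pos|assumption].
- assert (Eq : v (t0 + h) i - v1 i = h * - I01 (fun s => 1 * D i w s)).
  { assert (Ex := exact_v i w); change (hh w) with h in Ex; rewrite Ex.
    destruct (st_step w) as [_ [_ S]]; destruct (S i) as [I [HI EF]].
    apply integral01_I01 in HI; destruct HI as [X <-].
    change (st_v1 w) with v1 in EF; change (st_h w) with h in EF, X; rewrite EF.
    change (fun s => 1 * f (t0 + s * h) (st_Q w s) i) with (fun s => 1 * F i w s) in *.
    rewrite (I01_ext (fun s => 1 * D i w s)
      (fun s => 1 * F i w s - 1 * phi i w s)) by (intros; unfold D; ring).
    rewrite I01_minus; [ring|assumption|apply ex01_scal, cont01_ex01, cont01_phi]. }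
  rewrite Eq, Rabs_mult, Rabs_Ropp.
  replace (p + 1)%nat with (S p) by lia; simpl.
  rewrite (Rmult_comm (K i)), Rmult_assoc, (Rmult_comm _ (K i)).
  apply Rmult_le_compat_l; [apply Rabs_pos|assumption].
Qed.

(** One box containing both the stages and the exact solution, on which the bounds for f and its
    partial derivatives are taken. *)
Lemma trajectory_box : exists m, M <= m /\
  forall t, Rabs (t - t0) <= rho -> forall i, Rabs (q t i - q0 i) <= m.
Proof.
assert (B : forall i, exists K, 0 <= K /\ forall t, Rabs (t - t0) <= rho -> Rabs (q t i - q0 i) <= K).
{ intros i; apply (continuous_bounded (fun t => q t i - q0 i)); intros t Ht.
  apply @continuous_minus; [|apply continuous_const].
  apply (continuous_trajectory d (t0 - r) (t0 + r) q v q_deriv).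
  replace t with (t0 + (t - t0)) by ring; now apply time_in. }
destruct (functional_choice _ B) as [K HK].
assert (K0 : 0 <= vsum K) by (apply lsum_pos; intros; apply HK).
exists (Rabs M + vsum K); split; [generalize (Rle_abs M); lra|].
intros t Ht i; eapply Rle_trans; [apply HK, Ht|].
assert (K i <= vsum K) by (apply vsum_term_le; intros; apply HK).
generalize (Rabs_pos M); lra.
Qed.

Lemma D_bounded : forall i, BigO Om hh 0 (D i).
Proof.
intros i; destruct trajectory_box as [m [HM Hq]].
destruct (C0_bounded (fun t x => f t x i) t0 rho q0 m (smooth_f 0%nat i)) as [K [HK B]].
assert (T : forall (w : Om) s, 0 <= s <= 1 -> Rabs (t0 + s * hh w - t0) <= rho)
  by (intros; replace (t0 + s * hh w - t0) with (s * hh w) by ring; now apply sh_rho).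
apply BigO_minus; exists K; (split; [assumption|]); intros w s Hs;
  simpl; rewrite Rmult_1_r; apply B; auto.
intros j; eapply Rle_trans; [now apply (st_box w)|assumption].
Qed.

Lemma BigO_time (n : nat) (K : R) (g : R -> R) : 0 <= K ->
  (forall u, Rabs u <= rho -> Rabs (g u) <= K * Rabs u ^ n) ->
  BigO Om hh n (fun w s => g (s * hh w)).
Proof.
intros HK B; exists K; split; [assumption|]; intros w s Hs.
eapply Rle_trans; [now apply B, sh_rho|].
apply Rmult_le_compat_l; [assumption|].
apply pow_incr; split; [apply Rabs_pos|now apply sh_le].
Qed.

Lemma q_expand (i : Fin.t d) (c : nat -> R) (K : R) : 0 <= K ->
  (forall u, Rabs u <= rho -> Rabs (f (t0 + u) (q (t0 + u)) i - fsum 4 (fun k => c k * u ^ k))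
     <= K * Rabs u ^ 4) ->
  forall u, Rabs u <= rho -> Rabs (q (t0 + u) i - q0 i - u * v0 i
    - fsum 4 (fun k => c k * u ^ (k + 2) / ((INR k + 1) * (INR k + 2)))) <= K * Rabs u ^ 6.
Proof.
intros HK B.
assert (V : forall u, Rabs u <= rho -> Rabs (v (t0 + u) i - v t0 i
   - fsum 4 (fun k => c k * u ^ S (k + 0) / (INR (k + 0) + 1))) <= K * Rabs u ^ 5).
{ apply (expansion_primitive (fun t => v t i) (fun t => f t (q t) i)); [assumption| |].
  - intros u Hu; apply v_deriv; now apply time_in.
  - intros u Hu; rewrite (fsum_ext 4 _ (fun k => c k * u ^ k)); [now apply B|].
    intros; now rewrite Nat.add_0_r. }
intros u Hu.
(* The linear part is subtracted from q, so that its derivative is v - v0, whose expansion starts at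
   u^1; hence the offset 1. *)
assert (Q := expansion_primitive (fun t => q t i - (t - t0) * v0 i) (fun t => v t i - v t0 i)
   t0 rho K 4 1 5 (fun k => c k / (INR k + 1)) HK).
eapply Rle_trans; [|apply Q; [| |exact Hu]].
- right; f_equal; cbv beta.
  replace (fsum 4 (fun k => c k / (INR k + 1) * u ^ S (k + 1) / (INR (k + 1) + 1)))
    with (fsum 4 (fun k => c k * u ^ (k + 2) / ((INR k + 1) * (INR k + 2)))).
  + rewrite q_init; ring.
  + apply fsum_ext; intros k _.
    replace (k + 2)%nat with (S (k + 1)) by lia. rewrite plus_INR; simpl (INR 1).
    generalize (pos_INR k); intros; field; lra.
- intros s Hs; rewrite v_init.
  apply (is_derive_minus (V := R_NormedModule) (fun t => q t i)).
  + apply q_deriv; now apply time_in.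
  + auto_derive; [easy|ring].
- intros s Hs; rewrite (fsum_ext 4 _ (fun k => c k * s ^ S (k + 0) / (INR (k + 0) + 1)));
    [now apply V|].
  intros k _; rewrite Nat.add_0_r, Nat.add_1_r; generalize (pos_INR k); intros; field; lra.
Qed.

(** The stage equation and the twice integrated differential equation use the same Taylor
    coefficients c_k of f along the solution. Monomial by monomial they differ by h^(k+2) c_k e_k,
    and both remainders are O(h^6). *)
Lemma E_expansion : exists c : Fin.t d -> nat -> R, forall i, BigO Om hh 6 (fun w s => E i w s
  - hh w ^ 2 * (c i 0%nat * defect Abar 0 s + c i 1%nat * (hh w * defect Abar 1 s)
                + c i 2%nat * (hh w ^ 2 * defect Abar 2 s) + c i 3%nat * (hh w ^ 3 * defect Abar 3 s))
  - hh w ^ 2 * Aop Abar (D i w) s).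
Proof.
assert (T : forall i, exists c K, 0 <= K /\ forall u, Rabs u <= rho ->
  Rabs (f (t0 + u) (q (t0 + u)) i - fsum 4 (fun k => c k * u ^ k)) <= K * Rabs u ^ 4).
{ intros i; apply (taylor_bound 4 t0 r rho (fun t => f t (q t) i) rho_r).
  now apply (Cn_trajectory d f _ _ q v smooth_f q_deriv v_deriv 4 (fun t x => f t x i)). }
destruct (functional_choice _ T) as [c Hc]; exists c; intros i; destruct (Hc i) as [K [HK B]].
(* The Taylor remainder of f along the solution is O(h^4); the factor h^2 in the stage equation
   makes its contribution O(h^6). *)
set (rest := fun w s => phi i w s - fsum 4 (fun k => c i k * (s * hh w) ^ k)).
assert (Hpoly : forall w, cont01 (fun s => fsum 4 (fun k => c i k * (s * hh w) ^ k))).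
{ intros w; apply cont01_continuous; intros; apply @ex_derive_continuous; unfold fsum; auto_derive; easy. }
assert (R4 : BigO Om hh 4 rest)
  by (apply (BigO_time 4 K (fun u => f (t0 + u) (q (t0 + u)) i - fsum 4 (fun k => c i k * u ^ k)));
      assumption).
assert (RA : BigO Om hh 4 (fun w => Aop Abar (rest w))).
{ apply BigO_Aop; [now apply (kernel_bounded alpha)| |assumption].
  intros; apply cont01_ex01, cont01_mult; [now apply (cont01_kernel alpha)|].
  apply cont01_minus; [apply cont01_phi|apply Hpoly]. }
assert (R6 := BigO_time 6 K _ HK (q_expand i (c i) K HK B)).
apply (BigO_ext _ _ 6 (fun w s => hh w ^ 2 * Aop Abar (rest w) s
   - (q (t0 + s * hh w) i - q0 i - s * hh w * v0 i
      - fsum 4 (fun k => c i k * (s * hh w) ^ (k + 2) / ((INR k + 1) * (INR k + 2)))))).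
- intros w s Hs; unfold E.
  rewrite (proj2 (ex01_AF i w s Hs)), (Aop_F i w s Hs).
  assert (X : forall k, ex01 (fun u => Abar s u * u ^ k))
    by (intros; apply cont01_ex01, cont01_mult; [now apply (cont01_kernel alpha)|apply cont01_pow]).
  assert (Xr : ex01 (fun u => Abar s u * rest w u)).
  { apply cont01_ex01, cont01_mult; [now apply (cont01_kernel alpha)|].
    apply cont01_minus; [apply cont01_phi|apply Hpoly]. }
  assert (A : Aop Abar (phi i w) s = Aop Abar (rest w) s
     + (c i 0%nat * Aop Abar (fun u => u ^ 0) s + c i 1%nat * hh w * Aop Abar (fun u => u ^ 1) s
        + c i 2%nat * hh w ^ 2 * Aop Abar (fun u => u ^ 2) s
        + c i 3%nat * hh w ^ 3 * Aop Abar (fun u => u ^ 3) s)).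
  { unfold Aop; rewrite <- !I01_scal, <- !I01_plus by auto using ex01_plus, ex01_scal.
    apply I01_ext; intros u _; unfold rest; simpl; ring. }
  rewrite A; unfold defect, fsum; simpl. field.
- apply BigO_minus; [apply (BigO_h_mult _ _ 4 2), RA|exact R6].
Qed.

(** Two errors add up: linearising f about the exact solution costs O(|E|^2), and replacing the
    Jacobian by its quadratic Taylor polynomial costs O(h^3 |E|). *)
Lemma D_expansion : exists J : Fin.t d -> Fin.t d -> nat -> R,
  forall p, (p <= 3)%nat -> (forall j, BigO Om hh p (E j)) ->
  forall i, BigO Om hh (2 * p)
    (fun w s => D i w s - vsum (fun j => jacobian_poly hh J i j w s * E j w s)).
Proof.
assert (G : forall i, exists gx : Fin.t d -> R -> Vec d -> R,
  (forall j t x, derivable_pt_lim (fun s => f t (shift x j s) i) 0 (gx j t x)) /\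
  forall j, Ck 3 (gx j)).
{ intros i; destruct (smooth_f 4%nat i) as [_ [_ H]]; exact H. }
destruct (functional_choice _ G) as [gx Hgx]; clear G.
(* Pairs of indices make a single application of choice sufficient. *)
assert (T : forall ij : Fin.t d * Fin.t d, exists c K, 0 <= K /\ forall u, Rabs u <= rho ->
  Rabs (gx (fst ij) (snd ij) (t0 + u) (q (t0 + u)) - fsum 3 (fun k => c k * u ^ k)) <= K * Rabs u ^ 3).
{ intros [i j]; apply (taylor_bound 3 t0 r rho (fun t => gx i j t (q t)) rho_r).
  apply (Cn_trajectory d f _ _ q v smooth_f q_deriv v_deriv 3 (gx i j)), Hgx. }
destruct (functional_choice _ T) as [J HJ]; clear T.
exists (fun i j => J (i, j)); intros p Hp HE i.
destruct trajectory_box as [m [HM Hq]].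
destruct (quadratic_box (fun t x => f t x i) (gx i) t0 rho m q0) as [L [HL B]].
{ apply Hgx. }
{ intros j; do 2 apply Ck_weaken; apply Hgx. }
set (N := fun w s => vsum (fun j => Rabs (E j w s))).
apply (BigO_ext _ _ (2 * p) (fun w s =>
   (D i w s - vsum (fun j => gx i j (t0 + s * hh w) (q (t0 + s * hh w)) * E j w s))
   + vsum (fun j => (gx i j (t0 + s * hh w) (q (t0 + s * hh w))
                     - jacobian_poly hh (fun i j => J (i, j)) i j w s) * E j w s))).
- intros w s _; unfold vsum.
  rewrite (lsum_ext _ (fun j => (gx i j (t0 + s * hh w) (q (t0 + s * hh w))
       - jacobian_poly hh (fun i j => J (i, j)) i j w s) * E j w s)
    (fun j => gx i j (t0 + s * hh w) (q (t0 + s * hh w)) * E j w s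
       - jacobian_poly hh (fun i j => J (i, j)) i j w s * E j w s)), lsum_minus by (intros; ring).
  ring.
- apply BigO_plus.
  + apply (BigO_dom _ _ (2 * p) _ (fun w s => L * (N w s * N w s))).
    * intros w s Hs; eapply Rle_trans; [|apply Rle_abs].
      apply B.
      -- replace (t0 + s * hh w - t0) with (s * hh w) by ring; now apply sh_rho.
      -- intros j; apply Hq; replace (t0 + s * hh w - t0) with (s * hh w) by ring; now apply sh_rho.
      -- intros j; eapply Rle_trans; [now apply (st_box w)|assumption].
    * apply (BigO_mult0 _ _ (2 * p) (fun _ _ => L)); [apply BigO_const|].
      replace (2 * p)%nat with (p + p)%nat by lia.
      assert (BN : BigO Om hh p N).
      { apply (BigO_lsum _ _ (fins d) p (fun j w s => Rabs (E j w s))); intros j.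
        apply (BigO_dom _ _ p _ (E j)); [|apply HE]; intros; rewrite Rabs_Rabsolu; apply Rle_refl. }
      now apply BigO_mult.
  + apply (BigO_lsum _ _ (fins d) (2 * p) (fun j w s => (gx i j (t0 + s * hh w) (q (t0 + s * hh w))
      - jacobian_poly hh (fun i j => J (i, j)) i j w s) * E j w s)); intros j.
    apply (BigO_weaken _ _ hh_le_1 (2 * p) (3 + p)); [lia|].
    apply (BigO_mult _ _ 3 p (fun w s => gx i j (t0 + s * hh w) (q (t0 + s * hh w))
      - jacobian_poly hh (fun i j => J (i, j)) i j w s)); [|apply HE].
    destruct (HJ (i, j)) as [K [HK BJ]].
    apply (BigO_ext _ _ 3 (fun w s => gx i j (t0 + s * hh w) (q (t0 + s * hh w))
      - fsum 3 (fun k => J (i, j) k * (s * hh w) ^ k))).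
    * intros w s _; unfold jacobian_poly, fsum; ring.
    * now apply (BigO_time 3 K (fun u => gx i j (t0 + u) (q (t0 + u))
        - fsum 3 (fun k => J (i, j) k * u ^ k))).
Qed.

Lemma quadrature_order_2 : quadrature_order Om hh d D 2.
Proof.
destruct E_expansion as [c Hc], D_expansion as [J HJ].
exact (expansion_order2 alpha Abar kernel Om hh hh_le_1 d E D c J D_bounded ex01_D ex01_AD Hc HJ ex01_BD).
Qed.

Lemma quadrature_order_4 : alpha 0%nat 0%nat = 1 / 6 -> quadrature_order Om hh d D 4.
Proof.
destruct E_expansion as [c Hc], D_expansion as [J HJ].
exact (expansion_order4 alpha Abar kernel Om hh hh_le_1 d E D c J D_bounded ex01_D ex01_AD Hc HJ ex01_BD).
Qed.

Lemma quadrature_order_6 :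
  alpha 0%nat 0%nat = 1 / 6 -> alpha 1%nat 1%nat = - (1 / 10) ->
  alpha 2%nat 0%nat = sqrt 5 / 60 -> alpha 0%nat 2%nat = sqrt 5 / 60 ->
  (forall i : nat, (2 < i)%nat -> Nat.even i = true -> alpha i 0%nat = 0) ->
  quadrature_order Om hh d D 6.
Proof.
destruct E_expansion as [c Hc], D_expansion as [J HJ].
exact (expansion_order6 alpha Abar kernel Om hh hh_le_1 d E D c J D_bounded ex01_D ex01_AD Hc HJ ex01_BD).
Qed.

End Method.

(** * Symmetry of the method and assembly of the orders *)

Lemma symmetric_kernel (alpha : nat -> nat -> R) (Abar : R -> R -> R) :
  legendre_kernel alpha Abar ->
  csrkn_symmetric Abar (fun tau => 1 - tau) (fun _ => 1) (fun tau => tau).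
Proof.
intros H d f _ t0 h q0 v0 Q q1 v1 [HQ [Hq Hv]].
exists (fun tau => Q (1 - tau)).
set (F := fun i s => f (t0 + s * h) (Q s) i).
assert (X1 : forall i, ex01 (F i) /\ v1 i = v0 i + h * I01 (F i)).
{ intros i; destruct (Hv i) as [I [HI ->]]; apply integral01_I01 in HI.
  destruct HI as [X <-].
  assert (Ee : forall s, 0 <= s <= 1 -> 1 * f (t0 + s * h) (Q s) i = F i s)
    by (intros; unfold F; ring).
  split; [now apply (ex01_ext _ _ Ee)|now rewrite (I01_ext _ _ Ee)]. }
assert (X2 : forall i, ex01 (fun s => (1 - s) * F i s) /\
   q1 i = q0 i + h * v0 i + h ^ 2 * I01 (fun s => (1 - s) * F i s)).
{ intros i; destruct (Hq i) as [I [HI ->]]; apply integral01_I01 in HI.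
  destruct HI as [X <-]; now split. }
assert (EF : forall i s, f (t0 + h + s * - h) (Q (1 - s)) i = F i (1 - s)).
{ intros; unfold F; now replace (t0 + (1 - s) * h) with (t0 + h + s * - h) by ring. }
split; [|split].
- intros tau Ht i.
  destruct (HQ (1 - tau) ltac:(lra) i) as [I [HI EQ]]; apply integral01_I01 in HI.
  destruct HI as [X HI].
  change (ex01 (fun s => Abar (1 - tau) s * F i s)) in X.
  change (I01 (fun s => Abar (1 - tau) s * F i s) = I) in HI.
  (* The correction in the reflection identity is what the change of base point requires: its
     integrals int (1 - s) F and tau int F are those that express q1 and v1 through q0 and v0. *)
  set (g := fun s => Abar (1 - tau) s * F i s - ((1 - s) * F i s - tau * F i s)).
  assert (Xg : ex01 g).
  { apply ex01_minus; [exact X|apply ex01_minus; [apply X2|apply ex01_scal, X1]]. }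
  assert (Eg : forall s, 0 <= s <= 1 ->
     g (1 - s) = Abar tau s * f (t0 + h + s * - h) (Q (1 - s)) i).
  { intros s Hs; unfold g; rewrite EF, (kernel_reflect alpha) by (assumption || lra).
    replace (1 - (1 - s)) with s by ring; ring. }
  exists (I01 g); split.
  + apply integral01_I01; split.
    * apply (ex01_ext _ _ Eg), (ex01_reflect g), Xg.
    * now rewrite <- (I01_ext _ _ Eg), I01_reflect.
  + assert (X5 := ex01_scal tau _ (proj1 (X1 i))).
    unfold g; rewrite (I01_minus _ _ X (ex01_minus _ _ (proj1 (X2 i)) X5)),
      (I01_minus _ _ (proj1 (X2 i)) X5), (I01_scal tau _ (proj1 (X1 i))).
    rewrite HI, EQ, (proj2 (X1 i)), (proj2 (X2 i)); ring.
- intros i; set (g := fun s => F i s - (1 - s) * F i s).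
  assert (Xg : ex01 g) by exact (ex01_minus _ _ (proj1 (X1 i)) (proj1 (X2 i))).
  assert (Eg : forall s, 0 <= s <= 1 ->
     g (1 - s) = (1 - s) * f (t0 + h + s * - h) (Q (1 - s)) i)
    by (intros; unfold g; rewrite EF; ring).
  exists (I01 g); split.
  + apply integral01_I01; split.
    * apply (ex01_ext _ _ Eg), (ex01_reflect g), Xg.
    * now rewrite <- (I01_ext _ _ Eg), I01_reflect.
  + unfold g; rewrite (I01_minus _ _ (proj1 (X1 i)) (proj1 (X2 i))).
    rewrite (proj2 (X1 i)), (proj2 (X2 i)); ring.
- intros i.
  assert (Eg : forall s, 0 <= s <= 1 ->
     F i (1 - s) = 1 * f (t0 + h + s * - h) (Q (1 - s)) i) by (intros; rewrite EF; ring).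
  exists (I01 (F i)); split.
  + apply integral01_I01; split.
    * apply (ex01_ext _ _ Eg), (ex01_reflect (F i)), X1.
    * rewrite <- (I01_ext _ _ Eg); apply I01_reflect, X1.
  + rewrite (proj2 (X1 i)); ring.
Qed.

Lemma order_at_least (Abar : R -> R -> R) (p : nat) : (1 <= p)%nat ->
  (forall d f t0 q0 v0 r rho M (q v : R -> Vec d), smooth f -> rho < r -> rho <= 1 ->
    (forall t, t0 - r < t < t0 + r -> forall i, is_derive (fun s => q s i) t (v t i)) ->
    (forall t, t0 - r < t < t0 + r -> forall i, is_derive (fun s => v s i) t (f t (q t) i)) ->
    q t0 = q0 -> v t0 = v0 ->
    quadrature_order (step_of Abar f t0 q0 v0 rho M) st_h d
      (fun i w s => f (t0 + s * st_h w) (st_Q w s) i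
                    - f (t0 + s * st_h w) (q (t0 + s * st_h w)) i) p) ->
  csrkn_order_at_least Abar (fun tau => 1 - tau) (fun _ => 1) (fun tau => tau) p.
Proof.
intros Hp HQ d f Hf t0 q0 v0 r q v Hr Hd Hq Hv M.
assert (Dq : forall t, t0 - r < t < t0 + r -> forall i, is_derive (fun s => q s i) t (v t i))
  by (intros t Ht i; apply is_derive_Reals, (proj1 (Hd t Ht i))).
assert (Dv : forall t, t0 - r < t < t0 + r -> forall i, is_derive (fun s => v s i) t (f t (q t) i))
  by (intros t Ht i; apply is_derive_Reals, (proj2 (Hd t Ht i))).
(* The radius min(r/2, 1) stays strictly inside the interval of existence, as the Taylor bounds
   require, and keeps |h| <= 1, so that higher powers of h are smaller. *)
assert (R1 := Rmin_l (r / 2) 1); assert (R2 := Rmin_r (r / 2) 1).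
assert (R0 : 0 < Rmin (r / 2) 1) by (apply Rmin_pos; lra).
apply (order_of_quadrature Abar d f t0 q0 v0 r (Rmin (r / 2) 1) M q v); auto; try lra.
apply (HQ d f t0 q0 v0 r (Rmin (r / 2) 1) M q v); auto; lra.
Qed.

Theorem theorem3p4 (alpha : nat -> nat -> R) (Abar : R -> R -> R) :
  (forall eps, 0 < eps -> exists N : nat, forall n : nat, (N <= n)%nat ->
     forall tau sigma, 0 <= tau <= 1 -> 0 <= sigma <= 1 ->
       Rabs (Abar_base alpha tau sigma + Abar_psum alpha n tau sigma
             - Abar tau sigma) < eps) ->
  let Bbar := fun tau : R => 1 - tau in
  let B := fun _ : R => 1 in
  let C := fun tau : R => tau in
  csrkn_symmetric Abar Bbar B C /\
  csrkn_order_at_least Abar Bbar B C 2 /\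
  (alpha 0%nat 0%nat = 1 / 6 -> csrkn_order_at_least Abar Bbar B C 4) /\
  (alpha 0%nat 0%nat = 1 / 6 ->
   alpha 1%nat 1%nat = - (1 / 10) ->
   alpha 2%nat 0%nat = sqrt 5 / 60 ->
   alpha 0%nat 2%nat = sqrt 5 / 60 ->
   (forall i : nat, (2 < i)%nat -> Nat.even i = true -> alpha i 0%nat = 0) ->
   csrkn_order_at_least Abar Bbar B C 6).
Proof.
intros kernel Bbar B C; change (legendre_kernel alpha Abar) in kernel.
split; [now apply (symmetric_kernel alpha)|].
split; [|split].
- apply order_at_least; [lia|]; intros.
  now apply (quadrature_order_2 alpha Abar kernel d f t0 q0 v0 r rho M q v).
- intros a00; apply order_at_least; [lia|]; intros.
  now apply (quadrature_order_4 alpha Abar kernel d f t0 q0 v0 r rho M q v).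
- intros a00 a11 a20 a02 ai0; apply order_at_least; [lia|]; intros.
  now apply (quadrature_order_6 alpha Abar kernel d f t0 q0 v0 r rho M q v).
Qed.
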